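(* Let $M=\mathbb{S}(\mathcal{S}^3)$ be the spinor bundle of $\mathcal{S}^3$, equipped for each $c>0$ with the Bryant--Salamon torsion-free $\mathrm{G}_2$-structure $\varphi_c$, and let $M_0=M\setminus\mathcal{S}^3$ be the complement of the zero section, equipped with the conical $\mathrm{G}_2$-structure $\varphi_0$. (a) The canonical projection $\pi:M\to\mathcal{S}^3$ is a coassociative fibration with respect to $\varphi_c$, where the fibres are all $\mathrm{SO}(4)$-invariant and diffeomorphic to $\mathbb{R}^4$. (b) The canonical projection $\pi:M_0\to\mathcal{S}^3$ is a coassociative fibration with respect to $\varphi_0$, where the fibres are all $\mathrm{SO}(4)$-invariant and diffeomorphic to $\mathbb{R}^4\setminus\{0\}$.
   Context: Bryant--Salamon structure. Let $\sigma_1,\sigma_2,\sigma_3$ be the standard left-invariant coframe on $\mathcal{S}^3\cong\mathrm{SU}(2)$ with $d\sigma_1=\sigma_2\wedge\sigma_3$, $d\sigma_2=\sigma_3\wedge\sigma_1$, $d\sigma_3=\sigma_1\wedge\sigma_2$. Put $b_j=\frac12\sigma_j$ (an orthonormal coframe for the curvature $1$ metric), $\rho_j=-\frac14\sigma_j$ and $\mathrm{vol}_{\mathcal{S}^3}=b_1\wedge b_2\wedge b_3$. The bundle $M=\mathbb{S}(\mathcal{S}^3)$ is trivial, $M\cong\mathbb{R}^4\times\mathcal{S}^3$, with linear fibre coordinates $(a_0,a_1,a_2,a_3)$ and $r^2=a_0^2+a_1^2+a_2^2+a_3^2$; $\mathcal{S}^3\subset M$ denotes the zero section $r=0$. The vertical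 1-forms are $\zeta_0=da_0+a_1\rho_1+a_2\rho_2+a_3\rho_3$, $\zeta_1=da_1-a_0\rho_1+a_3\rho_2-a_2\rho_3$, $\zeta_2=da_2-a_3\rho_1-a_0\rho_2+a_1\rho_3$, $\zeta_3=da_3+a_2\rho_1-a_1\rho_2-a_0\rho_3$, and $\Omega_1=\zeta_0\wedge\zeta_1-\zeta_2\wedge\zeta_3$, $\Omega_2=\zeta_0\wedge\zeta_2-\zeta_3\wedge\zeta_1$, $\Omega_3=\zeta_0\wedge\zeta_3-\zeta_1\wedge\zeta_2$. For $c\ge0$ (on $M$ if $c>0$, on $M_0$ if $c=0$), $$\varphi_c=3\sqrt3(c+r^2)\,\mathrm{vol}_{\mathcal{S}^3}+4\sqrt3\,(b_1\wedge\Omega_1+b_2\wedge\Omega_2+b_3\wedge\Omega_3).$$ Group action. Identify $M\cong\mathbb{H}\times\mathcal{S}^3$, $\mathcal{S}^3\subset\mathbb{H}$ the unit quaternions. $\mathrm{SU}(2)^3$ acts by $(q_1,q_2,q_3)\cdot(\mathbf a,\mathbf x)=(q_1\mathbf a\bar q_3,\,q_2\mathbf x\bar q_3)$. The fibre over $\mathbf x$ is preserved by the subgroup of triples with $q_2=\mathbf x q_3\bar{\mathbf x}$, which acts on it by $\mathbf a\mapsto q_1\mathbf a\bar q_3$, i.e. as $\mathrm{SO}(4)$ on $\mathbb{R}^4$; this is the sense of ''$\mathrm{SO}(4)$-invariant''. Coassociative. An oriented 4-dimensional submanifold $N$ of a $\mathrm{G}_2$ manifold $(M,\varphi)$ is coassociative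 if $*_\varphi\varphi|_N=\mathrm{vol}_N$; equivalently, up to a choice of orientation, $\varphi|_N\equiv0$. Coassociative fibration. A $\mathrm{G}_2$ manifold $M$ admits a coassociative fibration if there is a 3-dimensional space $\mathcal{B}$ parametrizing a family of (not necessarily disjoint, possibly singular) coassociative submanifolds $N_b$, $b\in\mathcal{B}$, such that: every point of $M$ lies in at least one $N_b$, and $N_b$ is smooth for all $b$ in a dense open subset $\mathcal{B}^\circ\subset\mathcal{B}$; and there is a dense open subset $M'\subset M$ and a smooth locally trivial fibration $\pi:M'\to\mathcal{B}'$ onto a submanifold $\mathcal{B}'$ of $\mathcal{B}$ with $\pi^{-1}(b)=N_b\cap M'$ for $b\in\mathcal{B}'$. The set $M\setminus M'$ consists of the points where two members of the family intersect. *)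

(* Defs.v *)
From mathcomp Require Import all_boot all_order all_algebra.
From mathcomp Require Import all_classical all_reals all_analysis.

Set Implicit Arguments.
Unset Strict Implicit.
Unset Printing Implicit Defensive.

Import Order.TTheory GRing.Theory Num.Theory.
Import numFieldNormedType.Exports.

Local Open Scope classical_set_scope.
Local Open Scope ring_scope.

Local Notation "f @_ k" := (f (inord k))
  (at level 2, k at level 0, format "f @_ k").

(** * Smooth maps and manifolds

    Manifolds are subsets of an ambient space, and smoothness on a subset means
    local smooth extendability to the ambient space.  All ambient spaces are
    finite-dimensional in use: 'rV[R]_n, R and their products. *)

Fixpoint Ck_on (R : realType) (V W : normedModType R) (k : nat) (U : set V)
    (f : V -> W) : Prop :=
  match k with
  | 0 => forall x, U x -> {for x, continuous f}
  | k'.+1 => (forall x, U x -> differentiable f x) /\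
             (forall v : V, Ck_on k' U (fun x => 'D_v f x))
  end.

Definition Cinfty_on (R : realType) (V W : normedModType R) (U : set V)
  (f : V -> W) : Prop := forall k, Ck_on k U f.

Definition smooth_on (R : realType) (V W : normedModType R) (A : set V)
    (f : V -> W) : Prop :=
  forall x, A x -> exists (U : set V) (F : V -> W),
    [/\ open U, U x, Cinfty_on U F & forall y, A y -> U y -> F y = f y].

Definition diffeo_between (R : realType) (V W : normedModType R)
    (A : set V) (B : set W) (f : V -> W) (g : W -> V) : Prop :=
  [/\ smooth_on A f /\ smooth_on B g,
      forall x, A x -> B (f x), forall y, B y -> A (g y),
      forall x, A x -> g (f x) = x & forall y, B y -> f (g y) = y].

Definition diffeomorphic (R : realType) (V W : normedModType R)
    (A : set V) (B : set W) : Prop :=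
  exists (f : V -> W) (g : W -> V), diffeo_between A B f g.

Definition smooth_manifold (R : realType) (V : normedModType R) (k : nat)
    (A : set V) : Prop :=
  forall x, A x -> exists (W : set V) (U : set 'rV[R]_k),
    [/\ open W, W x, open U & diffeomorphic (A `&` W) U].

(* Velocities at time 0 of smooth curves in [A] through [p]. *)
Definition tangent (R : realType) (V : normedModType R) (A : set V) (p v : V)
    : Prop :=
  exists (e : R) (gamma : R -> V),
    [/\ 0 < e, Cinfty_on `]-e, e[%classic gamma,
        forall t, -e < t < e -> A (gamma t), gamma 0 = p & 'D_1 gamma 0 = v].

Definition dense_open_in (V : topologicalType) (A D : set V) : Prop :=
  (exists O : set V, open O /\ D = A `&` O) /\ A `<=` closure D.

Definition smooth_fibration (R : realType) (V W : normedModType R)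
    (E : set V) (B : set W) (pi : V -> W) : Prop :=
  [/\ smooth_on E pi, pi @` E = B &
      forall b, B b -> exists (O : set W) (l k : nat) (F : set 'rV[R]_l)
          (h : V -> W * 'rV[R]_l) (h' : W * 'rV[R]_l -> V),
        [/\ open O, O b, smooth_manifold k F,
            diffeo_between (E `&` pi @^-1` O) ((B `&` O) `*` F) h h' &
            forall e, E e -> O (pi e) -> (h e).1 = pi e]].

(** * Exterior algebra *)

Definition covec (R : realType) (V : normedModType R) := V -> R.
Definition form (R : realType) (V : normedModType R) (k : nat) :=
  ('I_k -> V) -> R.

Definition form1 (R : realType) (V : normedModType R) (a : covec V) : form V 1 :=
  fun v => a (v ord0).

(* Exterior product of a 1-form with a k-form, in the normalisation
   (a /\ b)(u, v) = a u * b v - a v * b u. *)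
Definition wedge (R : realType) (V : normedModType R) (k : nat) (a : covec V)
    (w : form V k) : form V k.+1 :=
  fun v => \sum_(i < k.+1) (-1) ^+ i * a (v i) * w (fun j => v (lift i j)).

Definition wedge2 (R : realType) (V : normedModType R) (a b : covec V)
  : form V 2 := wedge a (form1 b).
Definition wedge3 (R : realType) (V : normedModType R) (a b c : covec V)
  : form V 3 := wedge a (wedge2 b c).
Definition wedge4 (R : realType) (V : normedModType R) (a b c d : covec V)
  : form V 4 := wedge a (wedge3 b c d).

Definition alternating (R : realType) (V : normedModType R) (k : nat)
    (w : form V k) : Prop :=
  (forall (i : 'I_k) (v : 'I_k -> V) (s : R) (x y : V),
     w (fun j => if j == i then s *: x + y else v j) =
     s * w (fun j => if j == i then x else v j) +
     w (fun j => if j == i then y else v j)) /\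
  (forall (v : 'I_k -> V) (i j : 'I_k), i != j -> v i = v j -> w v = 0).

(** * G2 geometry

    The model is R^7 = R^3 + R^4 with coordinate covectors b_1, b_2, b_3
    (indices 0, 1, 2 below) and z_0, ..., z_3. *)

Definition Omega (R : realType) (V : normedModType R) (z : 'I_4 -> covec V)
    (j : 'I_3) : form V 2 :=
  fun v => nth 0 [:: wedge2 (z@_0) (z@_1) v - wedge2 (z@_2) (z@_3) v;
                     wedge2 (z@_0) (z@_2) v - wedge2 (z@_3) (z@_1) v;
                     wedge2 (z@_0) (z@_3) v - wedge2 (z@_1) (z@_2) v] j.

Definition vol3 (R : realType) (V : normedModType R) (b : 'I_3 -> covec V)
  : form V 3 := wedge3 (b@_0) (b@_1) (b@_2).

Definition b_Omega (R : realType) (V : normedModType R) (b : 'I_3 -> covec V)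
    (z : 'I_4 -> covec V) : form V 3 :=
  fun v => \sum_(j < 3) wedge (b j) (Omega z j) v.

Definition model_phi (R : realType) (V : normedModType R)
    (b : 'I_3 -> covec V) (z : 'I_4 -> covec V) : form V 3 :=
  fun v => vol3 b v + b_Omega b z v.

Definition model_metric (R : realType) (V : normedModType R)
    (b : 'I_3 -> covec V) (z : 'I_4 -> covec V) (u v : V) : R :=
  \sum_j b j u * b j v + \sum_k z k u * z k v.

(* Hodge dual of [model_phi] for [model_metric] and the orientation
   b_1 b_2 b_3 z_0 z_1 z_2 z_3. *)
Definition model_psi (R : realType) (V : normedModType R)
    (b : 'I_3 -> covec V) (z : 'I_4 -> covec V) : form V 4 :=
  fun v => wedge4 (z@_0) (z@_1) (z@_2) (z@_3) v
    - (wedge (b@_1) (wedge (b@_2) (Omega z (inord 0))) v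
       + wedge (b@_2) (wedge (b@_0) (Omega z (inord 1))) v
       + wedge (b@_0) (wedge (b@_1) (Omega z (inord 2))) v).

(* (b, z) restricts to a basis of the dual of T_p M which identifies [phi] with
   the model form.  As the stabiliser of the model form preserves the model
   metric and orientation, the metric and the 4-form *_phi phi on T_p M are
   [model_metric b z] and [model_psi b z] for any adapted coframe (b, z). *)
Definition adapted_coframe (R : realType) (V : normedModType R) (M : set V)
    (p : V) (phi : form V 3) (b : 'I_3 -> covec V) (z : 'I_4 -> covec V)
    : Prop :=
  [/\ (forall j, linear (b j : V -> R^o)) /\
        (forall k, linear (z k : V -> R^o)),
      forall u, tangent M p u ->
        (forall j, b j u = 0) -> (forall k, z k u = 0) -> u = 0,
      forall (s : 'I_3 -> R) (t : 'I_4 -> R), exists u,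
        [/\ tangent M p u, forall j, b j u = s j & forall k, z k u = t k] &
      forall v, (forall i, tangent M p (v i)) -> phi v = model_phi b z v].

(* An orientation of a k-manifold, given by a nowhere vanishing continuous
   k-form. *)
Definition orientation (R : realType) (V : normedModType R) (k : nat)
    (N : set V) (mu : V -> form V k) : Prop :=
  [/\ forall p, N p -> alternating (mu p),
      forall v, {within N, continuous (fun p => mu p v)} &
      forall p, N p -> exists v, (forall i, tangent N p (v i)) /\ mu p v != 0].

(* Riemannian volume form of a metric [g], for the orientation in which
   [mu] is positive. *)
Definition metric_vol (R : realType) (V : normedModType R) (k : nat)
    (g : V -> V -> R) (mu : form V k) : form V k :=
  fun v => Num.sg (mu v) * Num.sqrt (\det (\matrix_(i, j) g (v i) (v j))).

(* The orientation of [N] is part of the data in the calibration condition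
   *_phi phi |_N = vol_N; here it is existentially quantified. *)
Definition coassociative (R : realType) (V : normedModType R) (M : set V)
    (phi : V -> form V 3) (N : set V) : Prop :=
  [/\ N `<=` M, smooth_manifold 4 N &
      exists mu : V -> form V 4, orientation N mu /\
        forall p, N p -> exists b z,
          adapted_coframe M p (phi p) b z /\
          forall v, (forall i, tangent N p (v i)) ->
            model_psi b z v = metric_vol (model_metric b z) (mu p) v].

(* Members of a family may be singular: the calibration condition is then
   imposed on the regular locus, which has to be dense. *)
Definition regular_locus (R : realType) (V : normedModType R) (k : nat)
    (N : set V) : set V :=
  [set p | N p /\ exists W : set V,
     [/\ open W, W p & smooth_manifold k (N `&` W)]].

Definition singular_coassociative (R : realType) (V : normedModType R)
    (M : set V) (phi : V -> form V 3) (N : set V) : Prop :=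
  [/\ N `<=` M, N `<=` closure (regular_locus 4 N) &
      coassociative M phi (regular_locus 4 N)].

(* The conditions on the family [N b], b in [B], and on the locally trivial part
   pi : M' -> B'; (M, phi) is understood to be a G2 manifold. *)
Definition coassociative_fibration (R : realType) (V W : normedModType R)
    (M : set V) (phi : V -> form V 3) (B : set W) (N : W -> set V)
    (M' : set V) (B' : set W) (pi : V -> W) : Prop :=
  [/\ smooth_manifold 3 B /\
        (forall b, B b -> singular_coassociative M phi (N b)),
      forall p, M p -> exists2 b, B b & N b p,
      exists2 B0, dense_open_in B B0 &
        forall b, B0 b -> smooth_manifold 4 (N b),
      [/\ dense_open_in M M',
          B' `<=` B /\ (exists k, smooth_manifold k B'),
          smooth_fibration M' B' pi &
          forall b, B' b -> M' `&` pi @^-1` [set b] = N b `&` M'] &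
      M `\` M' = [set p | M p /\ exists b1 b2,
                     [/\ B b1, B b2, b1 <> b2, N b1 p & N b2 p]]].

(** * Quaternions *)

Definition row4 (R : realType) (a b c d : R) : 'rV[R]_4 :=
  \row_(j < 4) nth 0 [:: a; b; c; d] j.

Definition qmul (R : realType) (p q : 'rV[R]_4) : 'rV[R]_4 :=
  let p := p 0 in let q := q 0 in
  row4 (p@_0 * q@_0 - p@_1 * q@_1 - p@_2 * q@_2 - p@_3 * q@_3)
       (p@_0 * q@_1 + p@_1 * q@_0 + p@_2 * q@_3 - p@_3 * q@_2)
       (p@_0 * q@_2 - p@_1 * q@_3 + p@_2 * q@_0 + p@_3 * q@_1)
       (p@_0 * q@_3 + p@_1 * q@_2 - p@_2 * q@_1 + p@_3 * q@_0).

Definition qconj (R : realType) (p : 'rV[R]_4) : 'rV[R]_4 :=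
  let p := p 0 in row4 (p@_0) (- p@_1) (- p@_2) (- p@_3).

Definition sqnorm (R : realType) (p : 'rV[R]_4) : R := \sum_j p 0 j ^+ 2.

Definition S3 (R : realType) : set 'rV[R]_4 := [set x | sqnorm x = 1].

(** * The spinor bundle of S^3 and the Bryant-Salamon forms *)

Definition HH (R : realType) : normedModType R := ('rV[R]_4 * 'rV[R]_4)%type.

Definition spinorS3 (R : realType) : set (HH R) := [set p | S3 p.2].

Definition spinorS3_minus_zero (R : realType) : set (HH R) :=
  [set p | S3 p.2 /\ p.1 != 0].

Definition proj_base (R : realType) (p : HH R) : 'rV[R]_4 := p.2.

Definition fibre (R : realType) (M : set (HH R)) (x : 'rV[R]_4) : set (HH R) :=
  [set p | M p /\ proj_base p = x].

(* The imaginary part theta of conj(x) dx is left-invariant and satisfies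
   d theta_1 = - 2 theta_2 /\ theta_3 (and cyclically), so
   sigma_j = - 2 theta_j satisfies d sigma_1 = sigma_2 /\ sigma_3.
   The index j = 0, 1, 2 stands for sigma_1, sigma_2, sigma_3. *)
Definition sigma (R : realType) (p : HH R) (j : 'I_3) : covec (HH R) :=
  fun u => - 2 * qmul (qconj p.2) u.2 0 (lift ord0 j).

Definition bS3 (R : realType) (p : HH R) (j : 'I_3) : covec (HH R) :=
  fun u => 2^-1 * sigma p j u.

Definition rho (R : realType) (p : HH R) (j : 'I_3) : covec (HH R) :=
  fun u => - 4^-1 * sigma p j u.

Definition zeta (R : realType) (p : HH R) (k : 'I_4) : covec (HH R) :=
  fun u =>
  let a := p.1 0 in
  let da := u.1 0 in
  let r1 := (rho p)@_0 u in
  let r2 := (rho p)@_1 u in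
  let r3 := (rho p)@_2 u in
  nth 0 [:: da@_0 + a@_1 * r1 + a@_2 * r2 + a@_3 * r3;
            da@_1 - a@_0 * r1 + a@_3 * r2 - a@_2 * r3;
            da@_2 - a@_3 * r1 - a@_0 * r2 + a@_1 * r3;
            da@_3 + a@_2 * r1 - a@_1 * r2 - a@_0 * r3] k.

Definition phi_BS (R : realType) (c : R) (p : HH R) : form (HH R) 3 :=
  fun v => 3 * Num.sqrt 3 * (c + sqnorm p.1) * vol3 (bS3 p) v
           + 4 * Num.sqrt 3 * b_Omega (bS3 p) (zeta p) v.

(** * The group action *)

Definition act (R : realType) (q1 q2 q3 : 'rV[R]_4) (p : HH R) : HH R :=
  (qmul (qmul q1 p.1) (qconj q3), qmul (qmul q2 p.2) (qconj q3)).

Definition fibre_group (R : realType) (x q1 q2 q3 : 'rV[R]_4) : Prop :=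
  [/\ S3 q1, S3 q2, S3 q3 & q2 = qmul (qmul x q3) (qconj x)].

Definition SO4 (R : realType) : set 'M[R]_4 :=
  [set A | A *m A^T = 1%:M /\ \det A = 1].

(* A subset of the fibre over [x] is preserved by the subgroup of SU(2)^3
   preserving that fibre, which acts on the fibre exactly as SO(4). *)
Definition SO4_invariant (R : realType) (x : 'rV[R]_4) (N : set (HH R))
    : Prop :=
  [/\ forall q1 q2 q3, fibre_group x q1 q2 q3 -> act q1 q2 q3 @` N = N,
      forall q1 q2 q3, fibre_group x q1 q2 q3 -> exists2 A, SO4 A &
        forall a : 'rV[R]_4, act q1 q2 q3 (a, x) = (a *m A, x) &
      forall A : 'M[R]_4, SO4 A -> exists q1 q2 q3,
        fibre_group x q1 q2 q3 /\
        forall a : 'rV[R]_4, act q1 q2 q3 (a, x) = (a *m A, x)].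

(* Main.v *)
From HB Require Import structures.
Require Import Defs.
From mathcomp Require Import all_boot all_order all_algebra.
From mathcomp Require Import all_classical all_reals all_analysis.
From mathcomp Require Import ring lra.
Import Order.TTheory GRing.Theory Num.Theory.
Import numFieldNormedType.Exports.
Local Open Scope classical_set_scope.
Local Open Scope ring_scope.
Set Implicit Arguments.
Unset Strict Implicit.

(** On the vertical vectors at a point all sigma_j, hence all b_j and rho_j,
    vanish and zeta_k = da_k.  Every term of the model 4-form except
    z_0 /\ z_1 /\ z_2 /\ z_3 contains some b_j, so on a fibre this 4-form is the
    determinant of the z_k, which is also the volume form for the orientation
    of R^4.  An adapted coframe is (l b_j, m zeta_k) with
    l^3 = 3 sqrt 3 (c + r^2) and l m^2 = 4 sqrt 3: it exists as soon as
    c + r^2 > 0, which is the only place where c = 0 and r = 0 must be avoided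
    simultaneously.  Both parts of the theorem are thus the case F = R^4 or
    F = R^4 \ {0} of a statement on F x S^3, for F open and rotation invariant.

    That every rotation A of R^4 is a |-> q1 a conj q3 follows by correcting A
    with such maps so that it fixes 1, then i (conjugating by 1 - i v, where v
    is the image of i), then j (conjugating by 1 - j w); the determinant then
    forces it to fix k. *)

(** * Smooth functions *)

Section Calculus.
Context {R : realType}.
Implicit Types V W X : normedModType R.

(** An unbundled predicate: the maps below are plain functions, packed into linear structures only
    where a differential is computed. Continuity is a separate demand since the spaces are arbitrary
    normed modules. *)
Definition lincont V W (L : V -> W) :=
  linear L /\ continuous L.

Lemma lincont_differentiable V W (L : V -> W) x :
  lincont L -> differentiable L x.
Proof.
move=> [lL cL].
pose M := GRing.isLinear.Build _ _ _ _ L lL.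
pose LL : {linear V -> W} := HB.pack L M.
exact: (@linear_differentiable _ _ _ LL).
Qed.

Lemma lincont_derive V W (L : V -> W) x v : lincont L -> 'D_v L x = L v.
Proof.
move=> LP; rewrite deriveE; last exact: lincont_differentiable.
case: LP => lL cL.
pose M := GRing.isLinear.Build _ _ _ _ L lL.
pose LL : {linear V -> W} := HB.pack L M.
by rewrite (@diff_lin _ _ _ LL).
Qed.

Lemma derive_comp_lincont V W X (L : W -> X) (f : V -> W) x v :
  lincont L -> differentiable f x -> 'D_v (L \o f) x = L ('D_v f x).
Proof.
move=> LP df; have dL := lincont_differentiable (f x) LP.
rewrite !deriveE//; last exact: differentiable_comp.
by rewrite diff_comp//= -deriveE// lincont_derive.
Qed.

(** The first-order expansion of [f] only concerns points near [x], so it holds for [g] with the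
    same linear part; uniqueness of the differential then identifies ['d g x] with ['d f x]. *)
Lemma near_eq_differentiable V W (f g : V -> W) x :
  (\near x, f x = g x) -> differentiable f x -> differentiable g x.
Proof.
move=> fg df.
have dg : g \o shift x = cst (g x) + 'd f x +o_ 0 id.
  apply/eqaddoP => e e0.
  have /eqaddoP/(_ e e0) := diff_locally df.
  rewrite (nbhs_singleton fg) => fe.
  near=> y.
  have : `|(f \o shift x - (cst (g x) + 'd f x)) y| <= e * `|id y| by near: y.
  suff fgy : f (y + x) = g (y + x) by rewrite /= !fctE /= fgy.
  near: y.
  by move: fg; rewrite (near_shift 0 x)/=; apply: filterS => z; rewrite /= subr0.
have cf := diff_continuous df.
apply/diff_locallyP; rewrite (diff_unique cf dg).
by [].

Unshelve. all: by end_near. Qed.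

(** Formulas for derivatives usually hold only on [U], whereas [Ck_on] speaks of functions on the
    whole space. Since [U] is open, agreement on [U] passes to all directional derivatives; every
    induction below relies on this. *)
Lemma Ck_on_eq V W (k : nat) (U : set V) (f g : V -> W) : open U ->
  (forall x, U x -> f x = g x) -> Ck_on k U f -> Ck_on k U g.
Proof.
move=> oU; elim: k f g => [|k IH] f g fg /=.
  move=> cf x Ux.
  have nfg : \near x, f x = g x.
    by near do apply: fg; apply: open_nbhs_nbhs.
  rewrite /prop_for /continuous_at -(nbhs_singleton nfg).
  exact: cvg_trans (near_eq_cvg nfg) (cf x Ux).
move=> [df Df]; split=> [x Ux|v].
  apply: (near_eq_differentiable (f := f)) (df x Ux).
  by near do apply: fg; apply: open_nbhs_nbhs.
apply: IH (Df v) => x Ux; apply: near_eq_derive.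
by near do apply: fg; apply: open_nbhs_nbhs.
Unshelve. all: by end_near. Qed.

Lemma Ck_onW V W k (U : set V) (f : V -> W) : Ck_on k.+1 U f -> Ck_on k U f.
Proof.
elim: k f => [|k IH] f [df Df] /=.
  by move=> x /df; apply: differentiable_continuous.
by split => // v; apply: IH; apply: Df.
Qed.

Lemma Ck_on_sub V W k (U U' : set V) (f : V -> W) :
  U' `<=` U -> Ck_on k U f -> Ck_on k U' f.
Proof.
move=> sU; elim: k f => [|k IH] f /=; first by move=> cf x /sU /cf.
by move=> [df Df]; split=> [x /sU /df //|v]; exact: IH.
Qed.

Lemma Ck_on_cst V W k (U : set V) (a : W) : Ck_on k U (fun _ : V => a).
Proof.
elim: k a => [|k IH] a /=; first by move=> x _; exact: cst_continuous.
split=> [x _|v]; first exact: differentiable_cst.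
rewrite (_ : (fun x => 'D_v _ x) = fun=> 0); first exact: IH.
by apply/funext => x; rewrite -/(cst a) derive_cst.
Qed.

Lemma Ck_on_lincont V W k (U : set V) (L : V -> W) :
  lincont L -> Ck_on k U L.
Proof.
move=> LP; case: k => [|k] /=; first by move=> x _; exact: LP.2.
split=> [x _|v]; first exact: lincont_differentiable.
rewrite (_ : (fun x => 'D_v L x) = fun=> L v); first exact: Ck_on_cst.
by apply/funext => x; rewrite lincont_derive.
Qed.

Lemma Ck_on_comp_lincont V W X k (U : set V) (L : W -> X) (f : V -> W) :
  open U -> lincont L -> Ck_on k U f -> Ck_on k U (fun x => L (f x)).
Proof.
move=> oU LP; elim: k f => [|k IH] f /=.
  by move=> cf x Ux; apply: continuous_comp; [exact: cf|exact: LP.2].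
move=> [df Df]; split=> [x Ux|v].
  apply: (@differentiable_comp _ _ _ _ f L); first exact: df.
  exact: lincont_differentiable.
apply: Ck_on_eq (IH _ (Df v)) => // x Ux.
by rewrite -derive_comp_lincont//; exact: df.
Qed.

Lemma Ck_onD V W k (U : set V) (f g : V -> W) : open U ->
  Ck_on k U f -> Ck_on k U g -> Ck_on k U (fun x => f x + g x).
Proof.
move=> oU; elim: k f g => [|k IH] f g /=.
  by move=> cf cg x Ux; apply: cvgD; [exact: cf|exact: cg].
move=> [df Df] [dg Dg]; split=> [x Ux|v].
  by apply: (@differentiableD _ _ _ f g); [exact: df|exact: dg].
apply: Ck_on_eq (IH _ _ (Df v) (Dg v)) => // x Ux.
by apply/esym/(@deriveD _ _ _ f g); apply: diff_derivable; [exact: df|exact: dg].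
Qed.

(** Leibniz rule: the derivative is a sum of products of a derivative, known to be of class k, with
    one of the factors, whose regularity is lowered to k by [Ck_onW]. *)
Lemma Ck_onM V k (U : set V) (f g : V -> R) : open U ->
  Ck_on k U f -> Ck_on k U g -> Ck_on k U (fun x => f x * g x).
Proof.
move=> oU; elim: k f g => [|k IH] f g.
  by move=> cf cg x Ux; apply: cvgM; [exact: cf|exact: cg].
move=> Cf Cg; have [[df Df] [dg Dg]] := (Cf, Cg); split=> [x Ux|v].
  by apply: (@differentiableM _ _ f g); [exact: df|exact: dg].
have := Ck_onD oU (IH _ _ (Ck_onW Cf) (Dg v))
  (IH _ _ (Ck_onW Cg) (Df v)).
apply: Ck_on_eq => // x Ux.
by apply/esym/(@deriveM _ _ f g); apply: diff_derivable; [exact: df|exact: dg].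
Qed.

(** Induction through [D(1/f) = - (1/f)^2 Df], where [1/f] is of class k by the induction
    hypothesis. *)
Lemma Ck_onV V k (U : set V) (f : V -> R) : open U ->
  (forall x, U x -> f x != 0) -> Ck_on k U f -> Ck_on k U (fun x => (f x)^-1).
Proof.
move=> oU f0; elim: k => [|k IH].
  by move=> cf x Ux; apply: cvgV; [exact: f0|exact: cf].
move=> Cf; have [df Df] := Cf; split=> [x Ux|v].
  by apply: differentiableV; [exact: df|exact: f0].
have Cg := IH (Ck_onW Cf).
have := Ck_onM oU (Ck_on_cst k U (-1 : R))
  (Ck_onM oU (Ck_onM oU Cg Cg) (Df v)).
apply: Ck_on_eq => // x Ux; rewrite deriveV ?f0//; last first.
  exact/diff_derivable/df.
by rewrite /GRing.scale/= expr2 invfM; ring.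
Qed.

(** * Basic continuous linear maps and closure properties of smooth functions *)

Lemma lincont_fst V W : lincont (fst : V * W -> V).
Proof. by split=> // x; exact: cvg_fst. Qed.

Lemma lincont_snd V W : lincont (snd : V * W -> W).
Proof. by split=> // x; exact: cvg_snd. Qed.

Lemma lincont_inl V W : lincont (fun v : V => (v, 0 : W)).
Proof.
split=> [a u v|x]; last by apply: cvg_pair; [exact: cvg_id|exact: cvg_cst].
by congr pair; rewrite /= scaler0 addr0.
Qed.

Lemma lincont_inr V W : lincont (fun w : W => (0 : V, w)).
Proof.
split=> [a u v|x]; last by apply: cvg_pair; [exact: cvg_cst|exact: cvg_id].
by congr pair; rewrite /= scaler0 addr0.
Qed.

Lemma lincont_coord n (i : 'I_n) : lincont (fun v : 'rV[R]_n => v 0 i).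
Proof. by split=> [a u v|]; [rewrite !mxE|exact: coord_continuous]. Qed.

Lemma lincont_scalel V (v : V) : lincont (fun a : R => a *: v).
Proof.
split=> [a u w|]; last exact: scalel_continuous.
by rewrite scalerDl scalerA.
Qed.

Lemma Cinfty_on_lincont V W (U : set V) (L : V -> W) :
  lincont L -> Cinfty_on U L.
Proof. by move=> ? k; exact: Ck_on_lincont. Qed.

Lemma Cinfty_on_cst V W (U : set V) (a : W) : Cinfty_on U (fun _ : V => a).
Proof. by move=> k; exact: Ck_on_cst. Qed.

Section Cinfty.
Context {V : normedModType R} (U : set V) (oU : open U).

Lemma Cinfty_on_eq W (f g : V -> W) :
  (forall x, U x -> f x = g x) -> Cinfty_on U f -> Cinfty_on U g.
Proof. by move=> fg Cf k; exact: Ck_on_eq (Cf k). Qed.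

Lemma Cinfty_on_comp W X (L : W -> X) (f : V -> W) :
  lincont L -> Cinfty_on U f -> Cinfty_on U (fun x => L (f x)).
Proof. by move=> ? Cf k; exact: Ck_on_comp_lincont. Qed.

Lemma Cinfty_onD W (f g : V -> W) :
  Cinfty_on U f -> Cinfty_on U g -> Cinfty_on U (fun x => f x + g x).
Proof. by move=> Cf Cg k; exact: Ck_onD. Qed.

Lemma Cinfty_on_sum W n (f : 'I_n -> V -> W) :
  (forall i, Cinfty_on U (f i)) -> Cinfty_on U (fun x => \sum_(i < n) f i x).
Proof.
elim: n f => [|n IH] f Cf.
  by apply: Cinfty_on_eq (Cinfty_on_cst U 0) => x _; rewrite big_ord0.
apply: Cinfty_on_eq (Cinfty_onD (IH (fun i => f (widen_ord (leqnSn n) i)) _)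
  (Cf ord_max)) => [x _|i]; last exact: Cf.
by rewrite big_ord_recr.
Qed.

Lemma Cinfty_onM (f g : V -> R) :
  Cinfty_on U f -> Cinfty_on U g -> Cinfty_on U (fun x => f x * g x).
Proof. by move=> Cf Cg k; exact: Ck_onM. Qed.

Lemma Cinfty_onN (f : V -> R) :
  Cinfty_on U f -> Cinfty_on U (fun x => - f x).
Proof.
move=> /(Cinfty_onM (Cinfty_on_cst U (-1 : R))).
by apply: Cinfty_on_eq => x _; rewrite mulN1r.
Qed.

Lemma Cinfty_onV (f : V -> R) : (forall x, U x -> f x != 0) ->
  Cinfty_on U f -> Cinfty_on U (fun x => (f x)^-1).
Proof. by move=> f0 Cf k; exact: Ck_onV. Qed.

(** A pair is the sum of [(f, 0)] and [(0, g)], both compositions with linear injections. Rows are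
    treated in the same way below, with the standard basis. *)
Lemma Cinfty_on_pair W X (f : V -> W) (g : V -> X) :
  Cinfty_on U f -> Cinfty_on U g -> Cinfty_on U (fun x => (f x, g x)).
Proof.
move=> /(Cinfty_on_comp (lincont_inl W X)) Cf.
move=> /(Cinfty_on_comp (lincont_inr W X)) Cg.
apply: Cinfty_on_eq (Cinfty_onD Cf Cg) => x _.
by congr pair; rewrite /= ?addr0 ?add0r.
Qed.

Lemma Cinfty_on_row n (f : V -> 'rV[R]_n) :
  (forall i, Cinfty_on U (fun x => f x 0 i)) -> Cinfty_on U f.
Proof.
move=> Cf; apply: Cinfty_on_eq (Cinfty_on_sum (fun i =>
  Cinfty_on_comp (lincont_scalel (delta_mx 0 i)) (Cf i))) => x _.
by rewrite -row_sum_delta.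
Qed.

Lemma Cinfty_on_coord n (f : V -> 'rV[R]_n) i :
  Cinfty_on U f -> Cinfty_on U (fun x => f x 0 i).
Proof. exact: (Cinfty_on_comp (lincont_coord i)). Qed.

Lemma smooth_on_Cinfty W (A : set V) (f : V -> W) :
  A `<=` U -> Cinfty_on U f -> smooth_on A f.
Proof. by move=> AU Cf x Ax; exists U, f; split => //; exact: AU. Qed.

End Cinfty.

End Calculus.

(** * Quaternions and rotations of R^4 *)

Section Quaternions.
Context {R : realType}.
Implicit Types (p q : 'rV[R]_4) (a b c d : R).

Lemma row4_0 a b c d : row4 a b c d 0 (inord 0) = a.
Proof. by rewrite mxE inordK. Qed.
Lemma row4_1 a b c d : row4 a b c d 0 (inord 1) = b.
Proof. by rewrite mxE inordK. Qed.
Lemma row4_2 a b c d : row4 a b c d 0 (inord 2) = c.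
Proof. by rewrite mxE inordK. Qed.
Lemma row4_3 a b c d : row4 a b c d 0 (inord 3) = d.
Proof. by rewrite mxE inordK. Qed.

Definition row4E := (row4_0, row4_1, row4_2, row4_3).

Lemma ord4P (P : 'I_4 -> Prop) :
  P (inord 0) -> P (inord 1) -> P (inord 2) -> P (inord 3) -> forall i, P i.
Proof.
move=> P0 P1 P2 P3 i; rewrite -(inord_val i).
by case: i => [[|[|[|[|//]]]]] /=.
Qed.

Lemma big_ord4 (T : Type) (idx : T) (op : Monoid.law idx) (F : 'I_4 -> T) :
  \big[op/idx]_i F i =
  op (op (op (F (inord 0)) (F (inord 1))) (F (inord 2))) (F (inord 3)).
Proof.
rewrite !big_ord_recl big_ord0 Monoid.mulm1 !Monoid.mulmA.
by do 3?congr (op _ _); congr F; apply/val_inj; rewrite /= inordK.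
Qed.

Lemma row4P p q :
  p 0 (inord 0) = q 0 (inord 0) -> p 0 (inord 1) = q 0 (inord 1) ->
  p 0 (inord 2) = q 0 (inord 2) -> p 0 (inord 3) = q 0 (inord 3) -> p = q.
Proof. by move=> *; apply/rowP; apply: ord4P. Qed.

Lemma row4_ind (P : 'rV[R]_4 -> Prop) :
  (forall a b c d, P (row4 a b c d)) -> forall p, P p.
Proof.
move=> Prow p; rewrite (_ : p = row4 (p 0 (inord 0)) (p 0 (inord 1))
  (p 0 (inord 2)) (p 0 (inord 3)))//.
by apply: row4P; rewrite row4E.
Qed.

Lemma qmul_row4 a b c d a' b' c' d' : qmul (row4 a b c d) (row4 a' b' c' d') =
  row4 (a * a' - b * b' - c * c' - d * d') (a * b' + b * a' + c * d' - d * c')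
       (a * c' - b * d' + c * a' + d * b') (a * d' + b * c' - c * b' + d * a').
Proof. by rewrite /qmul !row4E. Qed.

Lemma qconj_row4 a b c d : qconj (row4 a b c d) = row4 a (- b) (- c) (- d).
Proof. by rewrite /qconj !row4E. Qed.

Lemma sqnorm_row4 a b c d :
  sqnorm (row4 a b c d) = a ^+ 2 + b ^+ 2 + c ^+ 2 + d ^+ 2.
Proof. by rewrite /sqnorm big_ord4 !row4E. Qed.

Lemma addr_row4 a b c d a' b' c' d' : row4 a b c d + row4 a' b' c' d' =
  row4 (a + a') (b + b') (c + c') (d + d').
Proof. by apply: row4P; rewrite mxE !row4E. Qed.

Lemma scaler_row4 k a b c d :
  k *: row4 a b c d = row4 (k * a) (k * b) (k * c) (k * d).
Proof. by apply: row4P; rewrite mxE !row4E. Qed.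

Definition qE := (qmul_row4, qconj_row4, sqnorm_row4, addr_row4, scaler_row4).

Notation qone := (row4 1 0 0 0 : 'rV[R]_4).

Lemma qmulA p q r : qmul p (qmul q r) = qmul (qmul p q) r.
Proof.
elim/row4_ind: p => *; elim/row4_ind: q => *; elim/row4_ind: r => *.
by rewrite !qE; congr row4; ring.
Qed.

Lemma qmul1q p : qmul qone p = p.
Proof. by elim/row4_ind: p => *; rewrite !qE; congr row4; ring. Qed.

Lemma qmulq1 p : qmul p qone = p.
Proof. by elim/row4_ind: p => *; rewrite !qE; congr row4; ring. Qed.

Lemma qmulDr p q r : qmul p (q + r) = qmul p q + qmul p r.
Proof.
elim/row4_ind: p => *; elim/row4_ind: q => *; elim/row4_ind: r => *.
by rewrite !qE; congr row4; ring.
Qed.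

Lemma qmulDl p q r : qmul (p + q) r = qmul p r + qmul q r.
Proof.
elim/row4_ind: p => *; elim/row4_ind: q => *; elim/row4_ind: r => *.
by rewrite !qE; congr row4; ring.
Qed.

Lemma qmulZr a p q : qmul p (a *: q) = a *: qmul p q.
Proof.
elim/row4_ind: p => *; elim/row4_ind: q => *.
by rewrite !qE; congr row4; ring.
Qed.

Lemma qmulq0 p : qmul p 0 = 0.
Proof. by have := qmulZr 0 p 0; rewrite !scale0r. Qed.

Lemma qmulZl a p q : qmul (a *: p) q = a *: qmul p q.
Proof.
elim/row4_ind: p => *; elim/row4_ind: q => *.
by rewrite !qE; congr row4; ring.
Qed.

Lemma qconjM p q : qconj (qmul p q) = qmul (qconj q) (qconj p).
Proof.
elim/row4_ind: p => *; elim/row4_ind: q => *.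
by rewrite !qE; congr row4; ring.
Qed.

Lemma qconjZ a p : qconj (a *: p) = a *: qconj p.
Proof. by elim/row4_ind: p => *; rewrite !qE; congr row4; ring. Qed.

Lemma qmul_conjl p : qmul (qconj p) p = sqnorm p *: qone.
Proof. by elim/row4_ind: p => *; rewrite !qE; congr row4; ring. Qed.

Lemma qmul_conjr p : qmul p (qconj p) = sqnorm p *: qone.
Proof. by elim/row4_ind: p => *; rewrite !qE; congr row4; ring. Qed.

Lemma sqnormM p q : sqnorm (qmul p q) = sqnorm p * sqnorm q.
Proof.
by elim/row4_ind: p => *; elim/row4_ind: q => *; rewrite !qE; ring.
Qed.

Lemma sqnormZ a p : sqnorm (a *: p) = a ^+ 2 * sqnorm p.
Proof. by elim/row4_ind: p => *; rewrite !qE; ring. Qed.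

Lemma sqnorm_conj p : sqnorm (qconj p) = sqnorm p.
Proof. by elim/row4_ind: p => *; rewrite !qE; ring. Qed.

Lemma sqnorm_ge0 p : 0 <= sqnorm p.
Proof. by rewrite /sqnorm sumr_ge0// => i _; rewrite sqr_ge0. Qed.

Lemma sqnorm_eq0 p : (sqnorm p == 0) = (p == 0).
Proof.
apply/eqP/eqP => [/eqP|->]; last first.
  by rewrite /sqnorm big1// => i _; rewrite mxE expr0n.
rewrite /sqnorm psumr_eq0 => [/allP p0|i _]; last exact: sqr_ge0.
apply/rowP => i; rewrite mxE; apply/eqP; rewrite -sqrf_eq0.
by apply: p0; rewrite mem_index_enum.
Qed.

Lemma S3_one : S3 qone.
Proof. by rewrite /S3/= !qE; ring. Qed.

Lemma S3M p q : S3 p -> S3 q -> S3 (qmul p q).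
Proof. by rewrite /S3/= sqnormM => -> ->; rewrite mulr1. Qed.

Lemma S3_conj p : S3 p -> S3 (qconj p).
Proof. by rewrite /S3/= sqnorm_conj. Qed.

Lemma S3_conjl p : S3 p -> qmul (qconj p) p = qone.
Proof. by rewrite /S3/= qmul_conjl => ->; rewrite scale1r. Qed.

Lemma S3_conjr p : S3 p -> qmul p (qconj p) = qone.
Proof. by rewrite /S3/= qmul_conjr => ->; rewrite scale1r. Qed.

Lemma S3_neq0 p : S3 p -> p != 0.
Proof. by rewrite /S3/= -sqnorm_eq0 => ->; rewrite oner_eq0. Qed.

Lemma S3_normalize p : p != 0 -> S3 ((Num.sqrt (sqnorm p))^-1 *: p).
Proof.
move=> p0; rewrite /S3/= sqnormZ exprVn sqr_sqrtr ?sqnorm_ge0//.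
by rewrite mulVf// sqnorm_eq0.
Qed.

(** * Inner product, and rotations given by pairs of unit quaternions *)

Definition qdot p q : R := (p *m q^T) 0 0.

Lemma qdot_row4 a b c d a' b' c' d' : qdot (row4 a b c d) (row4 a' b' c' d') =
  a * a' + b * b' + c * c' + d * d'.
Proof. by rewrite /qdot mxE big_ord4 !mxE !inordK. Qed.

Lemma sqnorm_dot p : sqnorm p = qdot p p.
Proof. by elim/row4_ind: p => *; rewrite qE qdot_row4; ring. Qed.

Lemma qdotM q1 q3 p q : qdot (qmul (qmul q1 p) q3) (qmul (qmul q1 q) q3) =
  sqnorm q1 * sqnorm q3 * qdot p q.
Proof.
elim/row4_ind: p => *; elim/row4_ind: q => *.
elim/row4_ind: q1 => *; elim/row4_ind: q3 => *.
by rewrite !qE !qdot_row4; ring.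
Qed.

(** For a unit [q] one has [(q + 1)^2 = (q + 1) q (conj q + 1) = |q + 1|^2 q], so [q + 1] normalised
    is a square root. This fails only at [q = -1], which is the square of [i]. *)
Lemma S3_sqrt q : S3 q -> exists2 s, S3 s & q = qmul s s.
Proof.
have [->|qN1] := eqVneq q (row4 (-1) 0 0 0) => [_|].
  exists (row4 0 1 0 0); first by rewrite /S3/= qE; ring.
  by rewrite !qE; congr row4; ring.
move=> q1; have n0 : q + qone != 0.
  apply: contra_neq qN1 => /eqP; rewrite addr_eq0 => /eqP ->.
  by rewrite -scaleN1r qE; congr row4; ring.
exists ((Num.sqrt (sqnorm (q + qone)))^-1 *: (q + qone)).
  exact: S3_normalize.
rewrite qmulZl qmulZr scalerA -invfM -expr2 sqr_sqrtr ?sqnorm_ge0//.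
apply: (@scalerI _ _ (sqnorm (q + qone))); first by rewrite sqnorm_eq0.
rewrite scalerA mulfV ?sqnorm_eq0// scale1r.
move: q1; rewrite /S3/=; elim/row4_ind: q {qN1 n0} => a b c d; rewrite !qE => N.
have -> : (a + 1) ^+ 2 + (b + 0) ^+ 2 + (c + 0) ^+ 2 + (d + 0) ^+ 2 =
  2 + 2 * a by nra.
by congr row4; [nra|ring..].
Qed.

(** Matrices act on row vectors from the right, so row [i] is the image of the basis vector [i], and
    composition reverses the order of the factors in [qmat_comp]. *)
Definition qmat q1 q3 : 'M[R]_4 :=
  \matrix_i qmul (qmul q1 (delta_mx 0 i)) (qconj q3).

Lemma mul_qmat q1 q3 p : p *m qmat q1 q3 = qmul (qmul q1 p) (qconj q3).
Proof.
rewrite mulmx_sum_row [in RHS](row_sum_delta p) !big_ord4.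
by rewrite !qmulDr !qmulDl !qmulZr !qmulZl !rowK.
Qed.

Lemma qmat_comp p1 p3 q1 q3 :
  qmat p1 p3 *m qmat q1 q3 = qmat (qmul q1 p1) (qmul q3 p3).
Proof.
by apply/row_matrixP => i; rewrite row_mul !rowK mul_qmat qconjM !qmulA.
Qed.

Lemma qmat_one : qmat qone qone = 1%:M.
Proof.
apply/row_matrixP => i; rewrite rowK row1 qmul1q.
by rewrite !qE !oppr0 qmulq1.
Qed.

Lemma row_dot (A : 'M[R]_4) i j : (A *m A^T) i j = qdot (row i A) (row j A).
Proof. by rewrite /qdot !mxE; apply: eq_bigr => k _; rewrite !mxE. Qed.

Lemma qmat_orth q1 q3 : S3 q1 -> S3 q3 -> qmat q1 q3 *m (qmat q1 q3)^T = 1%:M.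
Proof.
move=> u1 u3; apply/matrixP => i j; rewrite row_dot !rowK qdotM sqnorm_conj.
rewrite u1 u3 !mul1r /qdot trmx_delta mul_delta_mx_cond [RHS]mxE.
by case: (i == j); rewrite ?mulr1n ?mulr0n !mxE.
Qed.

Lemma qmat_SO4 q1 q3 : S3 q1 -> S3 q3 -> SO4 (qmat q1 q3).
Proof.
move=> u1 u3; split; first exact: qmat_orth.
(* qmat q1 q3 is the square of an orthogonal matrix. *)
have [s1 us1 ->] := S3_sqrt u1; have [s3 us3 ->] := S3_sqrt u3.
rewrite -qmat_comp det_mulmx.
by have := congr1 determinant (qmat_orth us1 us3); rewrite det_mulmx det_tr det1.
Qed.

Lemma SO4_mul (A B : 'M[R]_4) : SO4 A -> SO4 B -> SO4 (A *m B).
Proof.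
move=> [oA dA] [oB dB]; split; last by rewrite det_mulmx dA dB mulr1.
by rewrite trmx_mul mulmxA -(mulmxA A) oB mulmx1.
Qed.

(** Conjugation by [q] does not change when [q] is rescaled. It thus suffices to find a nonzero [q]
    with [q v = w q], an equation without inverses that can be checked on coordinates. *)
Lemma conj_unit q : q != 0 -> exists2 q', S3 q' &
  forall v w, qmul q v = qmul w q -> qmul (qmul q' v) (qconj q') = w.
Proof.
move=> q0; exists ((Num.sqrt (sqnorm q))^-1 *: q); first exact: S3_normalize.
move=> v w E; rewrite qconjZ !qmulZl qmulZr scalerA E -qmulA qmul_conjr.
rewrite -invfM -expr2 sqr_sqrtr ?sqnorm_ge0// qmulZr qmulq1 scalerA.
by rewrite mulVf ?sqnorm_eq0// scale1r.
Qed.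

Lemma conj_to_i (v : 'rV[R]_4) : sqnorm v = 1 -> v 0 (inord 0) = 0 ->
  exists2 q, S3 q & qmul (qmul q v) (qconj q) = row4 0 1 0 0.
Proof.
elim/row4_ind: v => a b c d; rewrite qE row4E => N a0.
rewrite {}a0 in N *; have [E|b1] := eqVneq b (-1).
  (* For [v = -i] the quaternion [1 - i v] vanishes; conjugation by [j] sends [-i] to [i]. *)
  have /conj_unit[q uq H] : row4 0 0 1 0 != 0 :> 'rV[R]_4.
    by rewrite -sqnorm_eq0 qE; apply/eqP; lra.
  exists q => //; apply: H; rewrite !qE.
  have [-> ->] : c = 0 /\ d = 0 by split; nra.
  by rewrite E; congr row4; ring.
(* These are the coordinates of [1 - i v]. As [v^2 = -1], both [q v] and [i q] equal [i + v]. *)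
have /conj_unit[q uq H] : row4 (1 + b) 0 d (- c) != 0.
  rewrite -sqnorm_eq0 qE; apply/eqP; move/eqP: b1; nra.
exists q => //; apply: H; rewrite !qE; congr row4; nra.
Qed.

(** For [v] in the span of [j] and [k], the product [j v] lies in the span of [1] and [i]. Hence
    [1 - j v] commutes with [i], and conjugation by it fixes [i] while sending [v] to [j]. For
    [v = -j] it vanishes and [i] replaces it. *)
Lemma conj_to_j (v : 'rV[R]_4) :
  sqnorm v = 1 -> v 0 (inord 0) = 0 -> v 0 (inord 1) = 0 ->
  exists q, [/\ S3 q, qmul (qmul q v) (qconj q) = row4 0 0 1 0 &
    qmul (qmul q (row4 0 1 0 0)) (qconj q) = row4 0 1 0 0].
Proof.
elim/row4_ind: v => a b c d; rewrite qE !row4E => N a0 b0.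
rewrite {}a0 {}b0 in N *; have [E|c1] := eqVneq c (-1).
  have /conj_unit[q uq H] : row4 0 1 0 0 != 0 :> 'rV[R]_4.
    by rewrite -sqnorm_eq0 qE; apply/eqP; lra.
  exists q; split => //; apply: H; rewrite !qE; last by congr row4; ring.
  have -> : d = 0 by nra.
  by rewrite E; congr row4; ring.
have /conj_unit[q uq H] : row4 (1 + c) (- d) 0 0 != 0.
  rewrite -sqnorm_eq0 qE; apply/eqP; move/eqP: c1; nra.
exists q; split => //; apply: H; rewrite !qE; congr row4; nra.
Qed.

Lemma SO4_qmat (A : 'M[R]_4) : SO4 A ->
  exists q1 q3, [/\ S3 q1, S3 q3 & A = qmat q1 q3].
Proof.
(* A correction by a quaternionic rotation can be undone with the conjugate pair, so it may be
   applied to the matrix before looking for [q1] and [q3]. *)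
have reduce (B : 'M[R]_4) p1 p3 : S3 p1 -> S3 p3 ->
    (exists q1 q3, [/\ S3 q1, S3 q3 & B *m qmat p1 p3 = qmat q1 q3]) ->
    exists q1 q3, [/\ S3 q1, S3 q3 & B = qmat q1 q3].
  move=> u1 u3 [q1 [q3 [v1 v3 E]]].
  exists (qmul (qconj p1) q1), (qmul (qconj p3) q3).
  split; [exact/S3M/v1/S3_conj|exact/S3M/v3/S3_conj|].
  by rewrite -qmat_comp -E -mulmxA qmat_comp !S3_conjl// qmat_one mulmx1.
have rows (B : 'M[R]_4) i j : SO4 B -> qdot (row i B) (row j B) = (i == j)%:R.
  by move=> [oB _]; rewrite -row_dot oB mxE.
have ordE (i j : nat) : (i < 4)%N -> (j < 4)%N ->
    (inord i == inord j :> 'I_4) = (i == j).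
  by move=> i4 j4; rewrite -val_eqE/= !inordK.
move=> SA.
have uA : S3 (row (inord 0) A) by rewrite /S3/= sqnorm_dot rows// eqxx.
(* Left multiplication by the conjugate of the image of [1] brings that image back to [1]. *)
apply: (reduce _ (qconj (row (inord 0) A)) qone); [exact: S3_conj|exact: S3_one|].
have : row (inord 0) (A *m qmat (qconj (row (inord 0) A)) qone) = qone.
  by rewrite row_mul mul_qmat S3_conjl// S3_conjr//; exact: S3_one.
have := SO4_mul SA (qmat_SO4 (S3_conj uA) S3_one).
move: (A *m _) => {uA SA A} A SA A0.
have vn : sqnorm (row (inord 1) A) = 1 by rewrite sqnorm_dot rows// eqxx.
(* Orthogonality to the first row, now [1], makes the image of [i] purely imaginary. *)
have := rows A (inord 0) (inord 1) SA; rewrite A0 ordE//=.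
have vE (v : 'rV[R]_4) : qdot qone v = v 0 (inord 0).
  by elim/row4_ind: v => *; rewrite qdot_row4 row4E; ring.
rewrite vE => v0; have [q uq qv] := conj_to_i vn v0.
apply: (reduce _ q q) => //.
have : row (inord 0) (A *m qmat q q) = qone.
  by rewrite row_mul mul_qmat A0 qmulq1 S3_conjr.
have : row (inord 1) (A *m qmat q q) = row4 0 1 0 0 by rewrite row_mul mul_qmat.
have := SO4_mul SA (qmat_SO4 uq uq).
move: (A *m _) => {SA A A0 vn v0 qv q uq} A SA A1 A0.
have vn : sqnorm (row (inord 2) A) = 1 by rewrite sqnorm_dot rows// eqxx.
have := rows A (inord 0) (inord 2) SA; rewrite A0 ordE//= vE => v0.
have vE1 (v : 'rV[R]_4) : qdot (row4 0 1 0 0) v = v 0 (inord 1).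
  by elim/row4_ind: v => *; rewrite qdot_row4 row4E; ring.
have := rows A (inord 1) (inord 2) SA; rewrite A1 ordE//= vE1 => v1.
have [q [uq qv qi]] := conj_to_j vn v0 v1.
apply: (reduce _ q q) => //.
have : row (inord 0) (A *m qmat q q) = qone.
  by rewrite row_mul mul_qmat A0 qmulq1 S3_conjr.
have : row (inord 1) (A *m qmat q q) = row4 0 1 0 0.
  by rewrite row_mul mul_qmat A1.
have : row (inord 2) (A *m qmat q q) = row4 0 0 1 0 by rewrite row_mul mul_qmat.
have := SO4_mul SA (qmat_SO4 uq uq).
move: (A *m _) => {SA A A0 A1 vn v0 v1 qv qi q uq} A SA A2 A1 A0.
have vE2 (v : 'rV[R]_4) : qdot (row4 0 0 1 0) v = v 0 (inord 2).
  by elim/row4_ind: v => *; rewrite qdot_row4 row4E; ring.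
(* The last row is orthogonal to [1], [i] and [j], hence a multiple of [k]. The matrix is then
   diagonal and its determinant is the last entry. *)
have := rows A (inord 0) (inord 3) SA; rewrite A0 ordE//= vE mxE => x0.
have := rows A (inord 1) (inord 3) SA; rewrite A1 ordE//= vE1 mxE => x1.
have := rows A (inord 2) (inord 3) SA; rewrite A2 ordE//= vE2 mxE => x2.
have AE i j : A i j = row i A 0 j by rewrite mxE.
have Adiag : A = diag_mx (row4 1 1 1 (A (inord 3) (inord 3))).
  apply/matrixP; apply: ord4P; apply: ord4P; rewrite mxE ordE//= ?row4E;
    by rewrite ?x0 ?x1 ?x2 // AE ?A0 ?A1 ?A2 ?row4E.
have A1m : A = 1%:M.
  case: SA => _; rewrite Adiag det_diag => d1.
  have : A (inord 3) (inord 3) = 1.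
    by move: d1; rewrite big_ord4 !row4E /= !mul1r.
  move=> ->; apply/matrixP => i j; rewrite !mxE.
  by move: i; apply: ord4P; rewrite !inordK.
exists qone, qone; split; [exact: S3_one|exact: S3_one|].
by rewrite A1m qmat_one.
Qed.

(** * The group action on a fibre *)

Lemma act_fibre (x q1 q2 q3 a : 'rV[R]_4) : S3 x -> fibre_group x q1 q2 q3 ->
  act q1 q2 q3 (a, x) = (qmul (qmul q1 a) (qconj q3), x).
Proof.
move=> ux [_ _ u3 ->]; congr pair; rewrite /= -(qmulA _ _ x) S3_conjl// qmulq1.
by rewrite -qmulA S3_conjr// qmulq1.
Qed.

(** The hypothesis on [F] has [q3] without conjugation, so that it applies both to the action and to
    its inverse [a |-> conj q1 a q3], which provides preimages. *)
Lemma SO4_invariant_fibre (x : 'rV[R]_4) (F : set 'rV[R]_4) : S3 x ->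
  (forall q1 q3 (a : 'rV[R]_4), S3 q1 -> S3 q3 -> F a -> F (qmul (qmul q1 a) q3)) ->
  SO4_invariant x (F `*` [set x]).
Proof.
move=> ux FF; split.
- move=> q1 q2 q3 G; have [u1 _ u3 _] := G.
  apply/seteqP; split=> [_ [[a _] [/= Fa ->] <-]|[a _] [/= Fa ->]].
    by rewrite act_fibre//; split => //=; apply: FF => //; exact: S3_conj.
  exists (qmul (qmul (qconj q1) a) q3, x).
    by split => //=; apply: FF => //; exact: S3_conj.
  rewrite act_fibre// -!qmulA S3_conjr// qmulq1.
  by rewrite qmulA S3_conjr// qmul1q.
- move=> q1 q2 q3 G; have [u1 _ u3 _] := G.
  by exists (qmat q1 q3) => [|a]; [exact: qmat_SO4|rewrite act_fibre// mul_qmat].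
- move=> A /SO4_qmat[q1 [q3 [u1 u3 ->]]].
  have G : fibre_group x q1 (qmul (qmul x q3) (qconj x)) q3.
    by split=> //; apply: S3M (S3_conj ux); exact: S3M.
  exists q1, (qmul (qmul x q3) (qconj x)), q3; split=> // a.
  by rewrite act_fibre// mul_qmat.
Qed.

End Quaternions.

(** * Stereographic charts of S^3 *)

Section Sphere.
Context {R : realType}.

Notation qone := (row4 1 0 0 0 : 'rV[R]_4).

Lemma Cinfty_on_id (V : normedModType R) (U : set V) : Cinfty_on U (@id V).
Proof. by apply: Cinfty_on_lincont; split => // x; exact: cvg_id. Qed.

Lemma open_neq0 (V : normedModType R) (f : V -> R) :
  Cinfty_on setT f -> open [set x | f x != 0].
Proof.
move=> /(_ 0%N) /= cf; apply: (@open_comp _ _ f [set y | y != 0]).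
  by move=> x _; exact: cf.
exact: open_neq.
Qed.

Lemma Cinfty_on_row4 (V : normedModType R) (U : set V) (f g h k : V -> R) :
  open U -> Cinfty_on U f -> Cinfty_on U g -> Cinfty_on U h ->
  Cinfty_on U k -> Cinfty_on U (fun x => row4 (f x) (g x) (h x) (k x)).
Proof.
move=> oU Cf Cg Ch Ck; apply: Cinfty_on_row => //.
by apply: ord4P; [apply: Cinfty_on_eq Cf|apply: Cinfty_on_eq Cg|
  apply: Cinfty_on_eq Ch|apply: Cinfty_on_eq Ck] => // x _; rewrite row4E.
Qed.

Lemma Cinfty_on_qmul (V : normedModType R) (U : set V) (f g : V -> 'rV[R]_4) :
  open U -> Cinfty_on U f -> Cinfty_on U g ->
  Cinfty_on U (fun x => qmul (f x) (g x)).
Proof.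
move=> oU Cf Cg; apply: Cinfty_on_row4 => //;
  by do ?[apply: Cinfty_onD|apply: Cinfty_onN|apply: Cinfty_onM|
          apply: Cinfty_on_coord].
Qed.

Definition imq (v : 'rV[R]_3) : 'rV[R]_4 :=
  row4 0 (v 0 (inord 0)) (v 0 (inord 1)) (v 0 (inord 2)).

(* Inverse of the stereographic projection from [- 1]. *)
Definition cayley (v : 'rV[R]_3) : 'rV[R]_4 :=
  (1 + sqnorm (imq v))^-1 *: ((1 - sqnorm (imq v)) *: qone + 2 *: imq v).

(** Stereographic projection from [-1], that is [Im y / (1 + Re y)]. At [-1] itself the convention
    [0^-1 = 0] yields a meaningless value, which the charts avoid. *)
Definition stereo (y : 'rV[R]_4) : 'rV[R]_3 :=
  \row_j ((1 + y 0 (inord 0))^-1 * y 0 (lift ord0 j)).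

Lemma ord3P (P : 'I_3 -> Prop) :
  P (inord 0) -> P (inord 1) -> P (inord 2) -> forall i, P i.
Proof.
move=> P0 P1 P2 i; rewrite -(inord_val i).
by case: i => [[|[|[|//]]]] /=.
Qed.

Lemma lift0_inord n k : (k < n.+1)%N ->
  lift (ord0 : 'I_n.+2) (inord k : 'I_n.+1) = inord k.+1.
Proof. by move=> kn; apply/val_inj; rewrite /= !inordK. Qed.

Lemma sqnorm_imq_neqN1 (v : 'rV[R]_3) : 1 + sqnorm (imq v) != 0.
Proof. by rewrite gt_eqF// ltr_pwDl// sqnorm_ge0. Qed.

Lemma cayleyE (v : 'rV[R]_3) : cayley v = (1 + sqnorm (imq v))^-1 *:
  row4 (1 - sqnorm (imq v)) (2 * v 0 (inord 0)) (2 * v 0 (inord 1))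
       (2 * v 0 (inord 2)).
Proof. by congr (_ *: _); rewrite /imq !qE; congr row4; ring. Qed.

Lemma S3_cayley (v : 'rV[R]_3) : S3 (cayley v).
Proof.
rewrite /S3/= cayleyE sqnormZ exprVn; apply: (canLR (mulKf _)).
  by rewrite expf_eq0/= sqnorm_imq_neqN1.
by rewrite /imq !qE; ring.
Qed.

(** Computes the denominator of [stereo] along [cayley]; as it is nonzero, [cayley] never reaches
    [-1]. *)
Lemma cayley_re (v : 'rV[R]_3) :
  1 + cayley v 0 (inord 0) = 2 * (1 + sqnorm (imq v))^-1.
Proof.
rewrite cayleyE mxE row4E; have := sqnorm_imq_neqN1 v.
by move: (sqnorm _) => n n1; field.
Qed.

Lemma stereo_cayley (v : 'rV[R]_3) : stereo (cayley v) = v.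
Proof.
apply/rowP => j; rewrite mxE cayley_re cayleyE mxE.
have n1 := sqnorm_imq_neqN1 v; 
have E (c z : R) : c != 0 -> (2 * c^-1)^-1 * (c^-1 * z) = z / 2.
  by move=> c0; field.
rewrite {}E//.
by move: j; apply: ord3P; rewrite lift0_inord// row4E; field.
Qed.

Lemma sqnorm_stereo (y : 'rV[R]_4) : S3 y -> 1 + y 0 (inord 0) != 0 ->
  sqnorm (imq (stereo y)) = (1 - y 0 (inord 0)) / (1 + y 0 (inord 0)).
Proof.
rewrite /S3/= /imq; elim/(@row4_ind R): y => a b c d.
rewrite ![stereo _ _ _]mxE !lift0_inord// !row4E !qE => N a1.
rewrite [LHS](_ : _ = (b ^+ 2 + c ^+ 2 + d ^+ 2) * (1 + a)^-1 ^+ 2); last by ring.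
have -> : b ^+ 2 + c ^+ 2 + d ^+ 2 = (1 - a) * (1 + a) by nra.
by field.
Qed.

Lemma cayley_stereo (y : 'rV[R]_4) : S3 y -> 1 + y 0 (inord 0) != 0 ->
  cayley (stereo y) = y.
Proof.
move=> uy y1; rewrite cayleyE sqnorm_stereo//.
rewrite ![stereo _ _ _]mxE !lift0_inord//.
set t := y 0 (inord 0) in y1 *.
have -> : 1 + (1 - t) / (1 + t) = 2 / (1 + t) by field.
by apply: row4P; rewrite mxE row4E -/t; field.
Qed.

Lemma Cinfty_on_sqnorm_imq (V : normedModType R) (U : set V) (f : V -> 'rV[R]_3) :
  open U -> Cinfty_on U f -> Cinfty_on U (fun x => sqnorm (imq (f x))).
Proof.
move=> oU Cf; apply: Cinfty_on_sum => // i; rewrite /GRing.exp/=.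
have C : Cinfty_on U (fun x => imq (f x)).
  by apply: Cinfty_on_row4; do ?[exact: Cinfty_on_cst|exact: Cinfty_on_coord].
by apply: Cinfty_onM => //; exact: Cinfty_on_coord.
Qed.

Lemma Cinfty_on_cayley (V : normedModType R) (U : set V) (f : V -> 'rV[R]_3) :
  open U -> Cinfty_on U f -> Cinfty_on U (fun x => cayley (f x)).
Proof.
move=> oU Cf; have CN := Cinfty_on_sqnorm_imq oU Cf.
have Ci : Cinfty_on U (fun x => (1 + sqnorm (imq (f x)))^-1).
  apply: Cinfty_onV => //; first by move=> x _; exact: sqnorm_imq_neqN1.
  by apply: Cinfty_onD => //; exact: Cinfty_on_cst.
apply: Cinfty_on_row => // i.
apply: (Cinfty_on_eq oU (f := fun x => (1 + sqnorm (imq (f x)))^-1 *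
  row4 (1 - sqnorm (imq (f x))) (2 * f x 0 (inord 0)) (2 * f x 0 (inord 1))
       (2 * f x 0 (inord 2)) 0 i)) => [x _|]; first by rewrite cayleyE [RHS]mxE.
apply: Cinfty_onM => //; apply: Cinfty_on_coord => //.
apply: Cinfty_on_row4 => //.
  by apply: Cinfty_onD => //; [exact: Cinfty_on_cst|exact: Cinfty_onN].
all: by apply: Cinfty_onM => //; [exact: Cinfty_on_cst|exact: Cinfty_on_coord].
Qed.

(** Left translation by [conj x] moves [x] to [1], so a single stereographic chart, translated,
    serves at every point. *)
Lemma smooth_manifold_S3 : smooth_manifold 3 (@S3 R).
Proof.
move=> x ux.
have Cx (U : set 'rV[R]_4) : open U ->
    Cinfty_on U (fun y => qmul (qconj x) y).
  move=> oU; apply: Cinfty_on_qmul => //; first exact: Cinfty_on_cst.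
  exact: Cinfty_on_id.
(* The denominator of the translated projection; on the sphere it vanishes only at [- x]. *)
pose h y := 1 + qmul (qconj x) y 0 (inord 0).
have Ch U : open U -> Cinfty_on U h.
  move=> oU; apply: Cinfty_onD => //; first exact: Cinfty_on_cst.
  by apply: Cinfty_on_coord => //; exact: Cx.
have oW := open_neq0 (Ch _ openT).
exists [set y | h y != 0], setT; split; [exact: oW| |exact: openT|].
  by rewrite /= /h S3_conjl// row4E -[1 + 1]/(2 : R) pnatr_eq0.
exists (fun y => stereo (qmul (qconj x) y)), (fun v => qmul x (cayley v)).
split=> //.
  - split.
      apply: (smooth_on_Cinfty oW); first by move=> y [].
      apply: Cinfty_on_row => // i.
      apply: (Cinfty_on_eq oW (f := fun y =>
        (h y)^-1 * qmul (qconj x) y 0 (lift ord0 i))) => [y _|].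
        by rewrite [RHS]mxE.
      apply: Cinfty_onM => //; last by apply: Cinfty_on_coord => //; exact: Cx.
      by apply: Cinfty_onV => //; exact: Ch.
    apply: (smooth_on_Cinfty openT) => //; apply: Cinfty_on_qmul openT _ _.
      exact: Cinfty_on_cst.
    by apply: Cinfty_on_cayley openT _; exact: Cinfty_on_id.
  - move=> v _; split; first exact: S3M ux (S3_cayley v).
    rewrite /h/= qmulA S3_conjl// qmul1q cayley_re mulf_neq0//.
    by rewrite invr_eq0 sqnorm_imq_neqN1.
  - move=> y [uy /= hy]; rewrite cayley_stereo//; last exact: S3M (S3_conj ux) uy.
    by rewrite qmulA S3_conjr// qmul1q.
  - by move=> v _; rewrite qmulA S3_conjl// qmul1q stereo_cayley.
Qed.

End Sphere.

(** * Tangent vectors *)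

Section Tangents.
Context {R : realType}.

Lemma near0_itv (P : R -> Prop) : (\forall t \near 0, P t) ->
  exists2 e : R, 0 < e & forall t, -e < t < e -> P t.
Proof.
move=> /nbhs_ballP[e /= e0 eP]; exists e => // t te.
by apply: eP; rewrite -ball_normE/= sub0r normrN ltr_norml.
Qed.

Lemma itv_near0 (P : R -> Prop) (e : R) : 0 < e ->
  (forall t, -e < t < e -> P t) -> \forall t \near 0, P t.
Proof.
move=> e0 eP; apply/nbhs_ballP; exists e => //= t.
by rewrite -ball_normE/= sub0r normrN ltr_norml => /eP.
Qed.

Lemma derive_near_cst (V : normedModType R) (f : R -> V) (x : V) :
  (\forall t \near 0, f t = x) -> 'D_1 f 0 = 0.
Proof. by move=> /(near_eq_derive (g := cst x)) ->; rewrite derive_cst. Qed.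

Lemma tangentP (V : normedModType R) (A : set V) p u : tangent A p u ->
  exists gamma : R -> V, [/\ differentiable gamma 0,
    \forall t \near 0, A (gamma t), gamma 0 = p & 'D_1 gamma 0 = u].
Proof.
move=> [e [g [e0 Cg gA g0 Dg]]]; exists g; split => //; last exact: itv_near0 gA.
by have [dg _] := Cg 1%N; apply: dg; rewrite /= in_itv/= oppr_lt0 e0.
Qed.

Lemma re_conj_mul (p u : 'rV[R]_4) :
  qmul (qconj p) u 0 (inord 0) = \sum_i p 0 i * u 0 i.
Proof.
elim/(@row4_ind R): p => *; elim/(@row4_ind R): u => *.
by rewrite big_ord4 !qE !row4E /=; ring.
Qed.

(** Differentiating [|g|^2 = 1] shows that [g'] is orthogonal to [g], and by [re_conj_mul] the inner
    product is the real part of [conj g g']. *)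
Lemma S3_near_orth (g : R -> 'rV[R]_4) : differentiable g 0 ->
  (\forall t \near 0, S3 (g t)) -> qmul (qconj (g 0)) ('D_1 g 0) 0 (inord 0) = 0.
Proof.
move=> dg gS.
have dgi i : differentiable (fun t => g t 0 i) 0.
  exact: differentiable_comp (differentiable_coord _ _ _).
have Dgi i : 'D_1 (fun t => g t 0 i) 0 = 'D_1 g 0 0 i.
  exact: (derive_comp_lincont (1 : R) (lincont_coord i) dg).
have /derive_near_cst : \forall t \near 0,
    (\sum_(i < 4) (fun t => g t 0 i) ^+ 2) t = 1.
  apply: filterS gS => t; rewrite /S3/= /sqnorm => <-.
  by rewrite fct_sumE; apply: eq_bigr => i _; rewrite fctE.
have dri i : derivable (fun t => g t 0 i) 0 1 by exact: diff_derivable.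
rewrite derive_sum; last by move=> i; exact: derivableX.
rewrite big_ord4 !deriveX// !Dgi/=.
rewrite re_conj_mul big_ord4 /GRing.scale/= !expr1 => H.
by apply: (mulfI (_ : 2 != 0)); [rewrite pnatr_eq0|lra].
Qed.

Lemma tangent_product_snd (F S : set 'rV[R]_4) (p u : HH R) :
  tangent (F `*` S : set (HH R)) p u ->
  exists g : R -> 'rV[R]_4, [/\ differentiable g 0,
    \forall t \near 0, S (g t), g 0 = p.2 & 'D_1 g 0 = u.2].
Proof.
move=> /tangentP[g [dg gA g0 Dg]]; exists (snd \o g).
have L := @lincont_snd R 'rV[R]_4 'rV[R]_4.
split; last 2 first.
- by rewrite /= g0.
- by rewrite (derive_comp_lincont (1 : R) L dg) Dg.
- exact: differentiable_comp (lincont_differentiable _ L).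
- by apply: filterS gA => t [].
Qed.

Lemma tangent_S3_orth (F : set 'rV[R]_4) (p u : HH R) :
  tangent (F `*` @S3 R : set (HH R)) p u ->
  qmul (qconj p.2) u.2 0 (inord 0) = 0.
Proof. by move=> /tangent_product_snd[g [dg gS <- <-]]; exact: S3_near_orth. Qed.

Lemma tangent_fibre_snd (F : set 'rV[R]_4) x (p u : HH R) :
  tangent (F `*` [set x] : set (HH R)) p u -> u.2 = 0.
Proof.
by move=> /tangent_product_snd[g [dg gS _ <-]]; exact: derive_near_cst gS.
Qed.

(** The curve is [(a + t da, g t)]. Openness of [F] keeps the first component in [F] for small
    [t]. *)
Lemma tangent_product (F S : set 'rV[R]_4) (a da x dx : 'rV[R]_4)
    (g : R -> 'rV[R]_4) : open F -> F a -> Cinfty_on setT g ->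
  (forall t, S (g t)) -> g 0 = x -> 'D_1 g 0 = dx ->
  tangent (F `*` S : set (HH R)) (a, x) (da, dx).
Proof.
move=> oF Fa Cg gS g0 Dg.
have lda := lincont_scalel da.
pose f t : 'rV[R]_4 := a + t *: da.
have Cf : Cinfty_on setT f.
  apply: Cinfty_onD; [exact: openT|exact: Cinfty_on_cst|exact: Cinfty_on_lincont].
have f0 : f 0 = a by rewrite /f scale0r addr0.
have [e e0 eF] : exists2 e : R, 0 < e & forall t, -e < t < e -> F (f t).
  apply: near0_itv; have cf : {for 0, continuous f} by exact: (Cf 0%N).
  by apply: cf; rewrite f0; exact: open_nbhs_nbhs.
have Cfg : Cinfty_on setT (fun t => (f t, g t) : HH R).
  by apply: Cinfty_on_pair => //; exact: openT.
exists e, (fun t => (f t, g t)); split => //; last 2 first.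
- by rewrite f0 g0.
- have dfg : differentiable (fun t => (f t, g t) : HH R) 0.
    by have [d _] := Cfg 1%N; exact: d.
  have D2 : ('D_1 (fun t => (f t, g t) : HH R) 0).2 = 'D_1 g 0.
    exact/esym/(derive_comp_lincont (1 : R) (@lincont_snd R _ _) dfg).
  have D1 : ('D_1 (fun t => (f t, g t) : HH R) 0).1 = 'D_1 f 0.
    exact/esym/(derive_comp_lincont (1 : R) (@lincont_fst R _ _) dfg).
  have Df : 'D_1 f 0 = da.
    rewrite (@deriveD _ _ _ (cst a) (fun t : R => t *: da)); first last.
    + exact/diff_derivable/lincont_differentiable.
    + exact/derivable_cst.
    by rewrite derive_cst add0r lincont_derive// scale1r.
  by rewrite [LHS]surjective_pairing D1 D2 Df Dg.
- by move=> k; apply: Ck_on_sub (Cfg k).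
- by move=> t te; split; [exact: eF|exact: gS].
Qed.

Lemma lincont_qmul (x : 'rV[R]_4) : lincont (qmul x).
Proof.
split=> [a u v|]; first by rewrite qmulDr qmulZr.
have C : Cinfty_on setT (qmul x).
  by apply: Cinfty_on_qmul openT _ _; [exact: Cinfty_on_cst|exact: Cinfty_on_id].
by move=> y; exact: (C 0%N).
Qed.

(** The coordinates of [cayley (t *: w)] are fractions of this shape. The denominator is 1 at 0 and
    has no linear term, so only the linear coefficient of the numerator survives. *)
Lemma derive_fraction0 (n a b c : R) :
  'D_1 (fun t : R => (1 + n * t ^+ 2)^-1 * (a + b * t + c * t ^+ 2)) 0 = b.
Proof.
pose q : {poly R} := 1 + n *: 'X^2.
pose p : {poly R} := a%:P + b *: 'X + c *: 'X^2.
pose Q : R -> R := horner q; pose P : R -> R := horner p.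
have hq t : q.[t] = 1 + n * t ^+ 2 by rewrite /q !hornerE.
have hp t : p.[t] = a + b * t + c * t ^+ 2 by rewrite /p !hornerE.
have -> : (fun t : R => (1 + n * t ^+ 2)^-1 * (a + b * t + c * t ^+ 2)) =
    (fun t => (Q t)^-1) * P.
  by apply/funext => t; rewrite fctE /Q /P hq hp.
have q0 : q.[0] != 0 by rewrite hq expr0n mulr0 addr0 oner_eq0.
have dq : derivable Q 0 1 by exact: derivable_horner.
have dp : derivable P 0 1 by exact: derivable_horner.
rewrite deriveM//
  (@deriveV _ _ Q)// -!derive1E /P /Q -!derivE hq hp.
have -> : (q^`()).[0] = 0.
  by rewrite /q !poly.derivE/= !hornerE/=; ring.
have -> : (p^`()).[0] = b.
  by rewrite /p !poly.derivE/= !hornerE/=; ring.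
by rewrite /GRing.scale/= expr0n/= mulr0 addr0 invr1; ring.
Qed.

Lemma derive_cayley (w : 'rV[R]_3) :
  'D_1 (fun t : R => cayley (t *: w)) 0 = 2 *: imq w.
Proof.
have Ch : Cinfty_on setT (fun t : R => cayley (t *: w)).
  apply: Cinfty_on_cayley openT _; apply: Cinfty_on_lincont.
  exact: lincont_scalel.
have dh : differentiable (fun t : R => cayley (t *: w)) 0.
  by have [d _] := Ch 1%N; exact: d.
have sE t : sqnorm (imq (t *: w)) = sqnorm (imq w) * t ^+ 2.
  by rewrite /imq !qE !mxE; ring.
apply/rowP => i; have := derive_comp_lincont (1 : R) (lincont_coord i) dh.
move=> <-.
suff [a [b [c [-> ->]]]] : exists a b c, (2 *: imq w) 0 i = b /\
    (fun v : 'rV[R]_4 => v 0 i) \o (fun t : R => cayley (t *: w)) =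
    fun t : R => (1 + sqnorm (imq w) * t ^+ 2)^-1 * (a + b * t + c * t ^+ 2).
  exact: derive_fraction0.
have E (r : R -> R) : (forall t, row4 (1 - sqnorm (imq (t *: w)))
      (2 * (t *: w) 0 (inord 0)) (2 * (t *: w) 0 (inord 1))
      (2 * (t *: w) 0 (inord 2)) 0 i = r t) ->
    (fun v : 'rV[R]_4 => v 0 i) \o (fun t : R => cayley (t *: w)) =
    fun t : R => (1 + sqnorm (imq w) * t ^+ 2)^-1 * r t.
  by move=> rE; apply/funext => t; rewrite /= cayleyE mxE rE sE.
move: i E; apply: ord4P => E.
- exists 1, 0, (- sqnorm (imq w)); rewrite mxE row4E mulr0; split => //.
  by apply: E => t; rewrite row4E sE; ring.
- exists 0, (2 * w 0 (inord 0)), 0; rewrite mxE row4E; split => //.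
  by apply: E => t; rewrite row4E mxE; ring.
- exists 0, (2 * w 0 (inord 1)), 0; rewrite mxE row4E; split => //.
  by apply: E => t; rewrite row4E mxE; ring.
- exists 0, (2 * w 0 (inord 2)), 0; rewrite mxE row4E; split => //.
  by apply: E => t; rewrite row4E mxE; ring.
Qed.

(** The base curve is [x cayley(t w)], whose velocity at 0 is [x] times the imaginary quaternion
    [2 w]. *)
Lemma tangent_spinor (F : set 'rV[R]_4) (a x da : 'rV[R]_4) (w : 'rV[R]_3) :
  open F -> F a -> S3 x ->
  tangent (F `*` @S3 R : set (HH R)) (a, x) (da, qmul x (2 *: imq w)).
Proof.
move=> oF Fa ux.
have Ch : Cinfty_on setT (fun t : R => cayley (t *: w)).
  apply: Cinfty_on_cayley openT _; apply: Cinfty_on_lincont.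
  exact: lincont_scalel.
have dh : differentiable (fun t : R => cayley (t *: w)) 0.
  by have [d _] := Ch 1%N; exact: d.
apply: (@tangent_product _ _ _ _ _ _ (fun t => qmul x (cayley (t *: w)))) => //.
- exact: (Cinfty_on_comp openT (lincont_qmul x) Ch).
- by move=> t; exact: S3M ux (S3_cayley _).
- rewrite scale0r cayleyE /imq !qE !mxE expr0n/= mulr0 !addr0 invr1 subr0 !mulr1.
  by rewrite mulr0 qmulq1.
- have := derive_comp_lincont (1 : R) (lincont_qmul x) dh.
  by rewrite derive_cayley.
Qed.

Lemma tangent_fibre (F : set 'rV[R]_4) (a x da : 'rV[R]_4) :
  open F -> F a -> tangent (F `*` [set x] : set (HH R)) (a, x) (da, 0).
Proof.
move=> oF Fa; apply: (@tangent_product _ _ _ _ _ _ (fun=> x)) => //.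
  exact: Cinfty_on_cst.
by rewrite -[fun=> x]/(cst x) derive_cst.
Qed.

End Tangents.

(** * Forms and the adapted coframe *)

Section Forms.
Context {R : realType} {V : normedModType R}.
Implicit Types (a : covec V) (b : 'I_3 -> covec V) (z : 'I_4 -> covec V).

Lemma wedgeZ k a (w : Defs.form V k) (l m : R) :
  wedge (fun u => l * a u) (fun v => m * w v) = fun v => l * m * wedge a w v.
Proof.
apply/funext => v; rewrite /wedge mulr_sumr; apply: eq_bigr => i _; ring.
Qed.

Lemma wedge_eq0 k a (w : Defs.form V k) v :
  (forall i, a (v i) = 0) -> wedge a w v = 0.
Proof. by move=> a0; rewrite /wedge big1// => i _; rewrite a0 mulr0 mul0r. Qed.

Lemma wedge2Z a a' (l m : R) : wedge2 (fun u => l * a u) (fun u => m * a' u) =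
  fun v => l * m * wedge2 a a' v.
Proof. exact: wedgeZ. Qed.

Lemma wedge3Z a a' a'' (l m n : R) :
  wedge3 (fun u => l * a u) (fun u => m * a' u) (fun u => n * a'' u) =
  fun v => l * (m * n) * wedge3 a a' a'' v.
Proof. by rewrite /wedge3 wedge2Z wedgeZ. Qed.

Lemma OmegaZ z (m : R) j :
  Omega (fun k u => m * z k u) j = fun v => m ^+ 2 * Omega z j v.
Proof.
apply/funext => v; rewrite /Omega !wedge2Z.
by case: j => [[|[|[|//]]]] ? /=; ring.
Qed.

(** The volume term is cubic in [b], while the other is linear in [b] and quadratic in [z]. This is
    the source of the two equations imposed on [l] and [m]. *)
Lemma model_phi_scale b z (l m : R) v :
  model_phi (fun j u => l * b j u) (fun k u => m * z k u) v =
  l ^+ 3 * vol3 b v + l * m ^+ 2 * b_Omega b z v.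
Proof.
rewrite /model_phi /vol3 wedge3Z /b_Omega; congr (_ + _).
rewrite mulr_sumr.
by apply: eq_bigr => j _; rewrite OmegaZ wedgeZ.
Qed.

(** The sum defining [wedge] is the Laplace expansion along the first column, so wedging with [a]
    adds a column in front. *)
Lemma wedge_det k a (s : seq (covec V)) (v : 'I_k.+1 -> V) :
  wedge a (fun v : 'I_k -> V => \det (\matrix_(i, j) nth a s j (v i))) v =
  \det (\matrix_(i, j) nth a (a :: s) j (v i)).
Proof.
rewrite (expand_det_col _ ord0) /wedge; apply: eq_bigr => i _.
rewrite /cofactor mxE addn0 mulrCA mulrA; congr (_ * \det _).
by apply/matrixP => i' j'; rewrite !mxE.
Qed.

Lemma wedge4_det z v : wedge4 (z (inord 0)) (z (inord 1)) (z (inord 2))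
  (z (inord 3)) v = \det (\matrix_(i, j) z j (v i)).
Proof.
have form1E a a0 : form1 a =
    fun v => \det (\matrix_(i, j < 1) nth a0 [:: a] j (v i)).
  by apply/funext => w; rewrite det_mx11 mxE.
(* In [wedge_det] the default of [nth] is the covector being added. When the list covers all columns
   the default is never reached, so one common [a0] can be used for all successive wedges. *)
have wE k a a0 (s : seq (covec V)) : (k <= size s)%N ->
   wedge a (fun v : 'I_k -> V => \det (\matrix_(i, j) nth a0 s j (v i))) =
   fun v => \det (\matrix_(i, j) nth a0 (a :: s) j (v i)).
  move=> ks; apply/funext => w.
  have E k' s' (w' : 'I_k' -> V) : (k' <= size s')%N ->
     \matrix_(i < k', j < k') nth a0 s' j (w' i) =
     \matrix_(i, j) nth a s' j (w' i).
    move=> ks'; apply/matrixP => i j; rewrite !mxE (set_nth_default a0)//.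
    exact: leq_trans (ltn_ord j) ks'.
  rewrite E// -wedge_det; congr wedge; apply/funext => w'; by rewrite E.
rewrite /wedge4 /wedge3 /wedge2 (form1E _ (z (inord 0))) !wE//.
congr determinant; apply/matrixP => i; apply: ord4P; rewrite !mxE inordK//=.
Qed.

(** The Gram matrix is [Z Z^T] for the matrix [Z] of the values of [z], and the square root of
    [(det Z)^2] is [|det Z|]. *)
Lemma metric_vol_det b z (mu : Defs.form V 4) v : (forall i j, b j (v i) = 0) ->
  metric_vol (model_metric b z) mu v =
  Num.sg (mu v) * `|\det (\matrix_(i, j) z j (v i))|.
Proof.
move=> b0; rewrite /metric_vol; congr (_ * _).
set Z := (X in `|\det X|).
have -> : \matrix_(i, j) model_metric b z (v i) (v j) = Z *m Z^T.
  apply/matrixP => i j; rewrite !mxE /model_metric big1 ?add0r.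
    by apply: eq_bigr => k _; rewrite !mxE.
  by move=> k _; rewrite b0 mul0r.
by rewrite det_mulmx det_tr -expr2 sqrtr_sqr.
Qed.

Lemma model_psi_det b z v : (forall i j, b j (v i) = 0) ->
  model_psi b z v = \det (\matrix_(i, j) z j (v i)).
Proof.
by move=> b0; rewrite /model_psi !wedge_eq0// !addr0 subr0 wedge4_det.
Qed.

End Forms.

(** * The Bryant--Salamon coframe *)

Section Coframe.
Context {R : realType}.
Implicit Types (p u : HH R).

Lemma cube_root (a : R) : 0 < a -> exists2 l, 0 < l & l ^+ 3 = a.
Proof.
move=> a0; exists (a `^ 3^-1); first exact: powR_gt0.
by rewrite -powR_mulrn ?powR_ge0// -powRrM mulVf ?pnatr_eq0// powRr1// ltW.
Qed.

Lemma bS3_linear p j : linear (bS3 p j : HH R -> R^o).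
Proof.
move=> k u v; rewrite /bS3 /sigma /= qmulDr qmulZr !mxE /GRing.scale/=; ring.
Qed.

Lemma rho_linear p j k u v : rho p j (k *: u + v) = k * rho p j u + rho p j v.
Proof. by rewrite /rho /sigma /= qmulDr qmulZr !mxE; ring. Qed.

Lemma zeta_linear p k : linear (zeta p k : HH R -> R^o).
Proof.
move=> s u v; move: k; apply: ord4P;
  rewrite /zeta !inordK//= !rho_linear !mxE /GRing.scale/=; ring.
Qed.

Lemma linear_scale (l : R) (f : HH R -> R) :
  linear (f : HH R -> R^o) -> linear ((fun u => l * f u) : HH R -> R^o).
Proof. by move=> lf k u v; rewrite lf /GRing.scale/=; ring. Qed.

Lemma zeta_split p k da dx : zeta p k (da, dx) = da 0 k + zeta p k (0, dx).
Proof.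
have rhoE j : rho p j (da, dx) = rho p j (0, dx) by [].
by move: k; apply: ord4P; rewrite /zeta !inordK//= !rhoE !mxE; ring.
Qed.

Lemma bS3_vertical p j u : u.2 = 0 -> bS3 p j u = 0.
Proof.
move=> u0; rewrite /bS3 /sigma u0.
by rewrite qmulq0 mxE !mulr0.
Qed.

Lemma zeta_vertical p k u : u.2 = 0 -> zeta p k u = u.1 0 k.
Proof.
case: u => da dx /= ->; rewrite zeta_split.
have r0 j : rho p j (0, 0) = 0.
  by have := bS3_vertical p j (u := (0, 0)) erefl; rewrite /bS3 /rho; lra.
suff -> : zeta p k (0, 0) = 0 by rewrite addr0.
by move: k; apply: ord4P; rewrite /zeta !inordK//= !r0 !mxE; ring.
Qed.

(** With [x = p.2], the imaginary coordinates of [conj x u.2] are the [bS3 p j u] up to sign. The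
    whole quaternion thus vanishes, and multiplication by [x] recovers [u.2]. *)
Lemma bS3_eq0_horizontal p u : S3 p.2 -> qmul (qconj p.2) u.2 0 (inord 0) = 0 ->
  (forall j, bS3 p j u = 0) -> u.2 = 0.
Proof.
move=> up u0 b0.
have b0' (j : 'I_3) : qmul (qconj p.2) u.2 0 (lift ord0 j) = 0.
  by have := b0 j; rewrite /bS3 /sigma; lra.
have z : qmul (qconj p.2) u.2 = 0.
  have := b0' (inord 0); have := b0' (inord 1); have := b0' (inord 2).
  by rewrite !lift0_inord// => *; apply: row4P; rewrite [RHS]mxE.
rewrite -[u.2]qmul1q -(S3_conjr up) -qmulA z.
by rewrite qmulq0.
Qed.

Lemma bS3_qmul_imq p da w j : S3 p.2 ->
  bS3 p j (da, qmul p.2 (2 *: imq w)) = -2 * w 0 j.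
Proof.
move=> up; rewrite /bS3 /sigma /= qmulA S3_conjl// qmul1q mxE.
by move: j; apply: ord3P; rewrite lift0_inord// row4E; field.
Qed.

Lemma adapted_coframe_BS (F : set 'rV[R]_4) (c : R) p (l m : R) :
  open F -> F p.1 -> S3 p.2 -> 0 < l -> 0 < m ->
  l ^+ 3 = 3 * Num.sqrt 3 * (c + sqnorm p.1) -> l * m ^+ 2 = 4 * Num.sqrt 3 ->
  adapted_coframe (F `*` @S3 R : set (HH R)) p (phi_BS c p)
    (fun j u => l * bS3 p j u) (fun k u => m * zeta p k u).
Proof.
move=> oF Fp up l0 m0 l3 m2; split.
- split=> k; apply: linear_scale; [exact: bS3_linear|exact: zeta_linear].
- move=> u Tu bu zu.
  have u2 : u.2 = 0.
    apply: (bS3_eq0_horizontal up); first exact: tangent_S3_orth Tu.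
    by move=> j; apply: (mulfI (lt0r_neq0 l0)); rewrite mulr0.
  rewrite [u]surjective_pairing u2; congr pair; apply/rowP => k.
  apply: (mulfI (lt0r_neq0 m0)).
  by rewrite -(zeta_vertical p k u2) zu mxE mulr0.
- move=> s t.
  (* The covector [bS3 p j] takes the value [-2 w_j] on [x (2 w)], so this [w] gives [l b_j = s_j].
     The vertical part [da] then compensates the connection terms of [zeta] on [dx]. *)
  pose w : 'rV[R]_3 := \row_j (- (s j / (2 * l))).
  pose dx := qmul p.2 (2 *: imq w).
  pose da : 'rV[R]_4 := \row_k (t k / m - zeta p k (0, dx)).
  exists (da, dx); split.
  + by rewrite [p]surjective_pairing; exact: tangent_spinor.
  + by move=> j; rewrite bS3_qmul_imq// mxE; field; exact: lt0r_neq0.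
  + by move=> k; rewrite zeta_split mxE subrK mulrC divfK// lt0r_neq0.
- by move=> v _; rewrite model_phi_scale l3 m2.
Qed.

End Coframe.

(** * The fibration *)

Section Fibration.
Context {R : realType}.

Lemma smooth_manifold_open k (F : set 'rV[R]_k) : open F -> smooth_manifold k F.
Proof.
move=> oF x Fx; exists setT, F; split => //; first exact: openT.
exists id, id; split=> //; first split.
- by apply: (smooth_on_Cinfty openT) => //; exact: Cinfty_on_id.
- by apply: (smooth_on_Cinfty openT) => //; exact: Cinfty_on_id.
- by move=> y [].
Qed.

Lemma diffeomorphic_fibre (F : set 'rV[R]_4) (x : 'rV[R]_4) :
  diffeomorphic (F `*` [set x] : set (HH R)) F.
Proof.
exists fst, (fun a => (a, x)); split=> //; first split.
- apply: (smooth_on_Cinfty openT) => //; apply: Cinfty_on_lincont.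
  exact: lincont_fst.
- apply: (smooth_on_Cinfty openT) => //; apply: (Cinfty_on_pair openT).
    exact: Cinfty_on_id.
  exact: Cinfty_on_cst.
- by move=> y [].
- by move=> [a y] [_ /= ->].
Qed.

Lemma smooth_manifold_fibre (F : set 'rV[R]_4) (x : 'rV[R]_4) :
  open F -> smooth_manifold 4 (F `*` [set x] : set (HH R)).
Proof.
move=> oF p Fp; exists setT, F; rewrite setIT; split => //; first exact: openT.
exact: diffeomorphic_fibre.
Qed.

(** The constant form [da_0 da_1 da_2 da_3]. *)
Definition fibre_orientation (_ : HH R) (v : 'I_4 -> HH R) : R :=
  \det (\matrix_(i, k) (v i).1 0 k).

Lemma orientation_fibre (F : set 'rV[R]_4) (x : 'rV[R]_4) : open F ->
  orientation (F `*` [set x] : set (HH R)) fibre_orientation.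
Proof.
move=> oF; split.
- move=> p _; split=> [i v s y z|v i j ij vij]; last first.
    by apply: (determinant_alternate ij) => k; rewrite !mxE vij.
  have := @determinant_multilinear R 4
    (\matrix_(j, k) (if j == i then s *: y + z else v j).1 0 k)
    (\matrix_(j, k) (if j == i then y else v j).1 0 k)
    (\matrix_(j, k) (if j == i then z else v j).1 0 k) i s 1.
  rewrite mul1r; apply.
  + by apply/rowP => k; rewrite !mxE !eqxx /= !mxE mul1r.
  + by apply/matrixP => j k; rewrite !mxE ![lift _ _ == _]eq_sym
      !(negPf (neq_lift _ _)).
  + by apply/matrixP => j k; rewrite !mxE ![lift _ _ == _]eq_sym
      !(negPf (neq_lift _ _)).
- move=> v; apply: continuous_subspaceT => p; exact: cvg_cst.
- move=> [a y] [Fa /= ->]; exists (fun i => (delta_mx 0 i, 0)); split.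
    by move=> i; exact: tangent_fibre.
  rewrite /fibre_orientation (_ : \matrix_(i, k) _ = 1%:M) ?det1 ?oner_eq0//.
  by apply/matrixP => i k; rewrite !mxE eq_sym.
Qed.

Lemma coassociative_fibre (F : set 'rV[R]_4) (c : R) (x : 'rV[R]_4) :
  open F -> (forall a, F a -> 0 < c + sqnorm a) -> S3 x ->
  coassociative (F `*` @S3 R : set (HH R)) (phi_BS c) (F `*` [set x]).
Proof.
move=> oF Fc ux; split.
- by move=> [a y] [Fa /= ->].
- exact: smooth_manifold_fibre.
exists fibre_orientation; split; first exact: orientation_fibre.
move=> p [Fp px]; have up : S3 p.2 by rewrite px.
have s3 : 0 < Num.sqrt 3 :> R by rewrite sqrtr_gt0.
have K0 : 0 < 3 * Num.sqrt 3 * (c + sqnorm p.1).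
  by rewrite mulr_gt0// ?Fc// mulr_gt0.
have [l l0 l3] := cube_root K0.
have ml : 0 < 4 * Num.sqrt 3 / l :> R by rewrite divr_gt0// mulr_gt0.
(* Once [l] is fixed by the volume coefficient, [m] is determined by [l m^2 = 4 sqrt 3]. *)
pose m := Num.sqrt (4 * Num.sqrt 3 / l).
have m0 : 0 < m by rewrite sqrtr_gt0.
have m2 : l * m ^+ 2 = 4 * Num.sqrt 3.
  by rewrite sqr_sqrtr ?ltW// mulrC divfK// lt0r_neq0.
exists (fun j u => l * bS3 p j u), (fun k u => m * zeta p k u).
split; first exact: adapted_coframe_BS.
move=> v Tv; have v2 i : (v i).2 = 0 by exact: tangent_fibre_snd (Tv i).
have b0 i j : l * bS3 p j (v i) = 0 by rewrite bS3_vertical ?mulr0.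
rewrite model_psi_det// metric_vol_det//.
have -> : \matrix_(i, j) (m * zeta p j (v i)) =
    m *: \matrix_(i < 4, k < 4) (v i).1 0 k.
  by apply/matrixP => i j; rewrite !mxE zeta_vertical.
(* Both sides are [m^4] times the determinant of the vertical components: [m^4] is nonnegative, and
   the sign of the orientation undoes the absolute value. *)
rewrite detZ normrM (ger0_norm (exprn_ge0 _ (ltW m0))) mulrCA.
by rewrite /fibre_orientation mulr_sg_norm.
Qed.

Lemma fibre_product (F : set 'rV[R]_4) (x : 'rV[R]_4) : S3 x ->
  fibre (F `*` @S3 R) x = F `*` [set x].
Proof.
move=> ux; apply/seteqP; split=> [[a y] [[Fa _]]|[a y] [Fa]] //= yx.
by rewrite /fibre/= yx.
Qed.

Lemma regular_locus_manifold (V : normedModType R) k (N : set V) :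
  smooth_manifold k N -> regular_locus k N = N.
Proof.
move=> mN; apply/seteqP; split=> [p []//|p Np]; split=> //.
by exists setT; rewrite setIT; split => //; exact: openT.
Qed.

Lemma dense_open_in_refl (V : topologicalType) (A : set V) : dense_open_in A A.
Proof.
split; last exact: subset_closure.
by exists setT; rewrite setIT; split => //; exact: openT.
Qed.

(** Exchanging the two factors is a global trivialisation with typical fibre [F]; a point of [F] is
    needed for surjectivity onto the sphere. *)
Lemma smooth_fibration_product (F : set 'rV[R]_4) : open F -> F !=set0 ->
  smooth_fibration (F `*` @S3 R : set (HH R)) (@S3 R) (@proj_base R).
Proof.
move=> oF [a0 Fa0].
have Cfst := Cinfty_on_lincont setT (@lincont_fst R 'rV[R]_4 'rV[R]_4).
have Csnd := Cinfty_on_lincont setT (@lincont_snd R 'rV[R]_4 'rV[R]_4).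
split.
- exact: (smooth_on_Cinfty openT).
- apply/seteqP; split=> [_ [p [_ up] <-]//|x ux].
  by exists (a0, x).
move=> b ub.
exists setT, 4%N, 4%N, F, (fun p => (p.2, p.1)), (fun p => (p.2, p.1)).
split => //; [exact: openT|exact: smooth_manifold_open|].
rewrite preimage_setT !setIT; split => //.
- by split; apply: (smooth_on_Cinfty openT) => //; exact: (Cinfty_on_pair openT).
- by move=> p [].
- by move=> p [].
- by move=> [].
- by move=> [].
Qed.

(** All members are smooth, so each is its own regular locus. They are also disjoint, so the locally
    trivial part is the whole total space over the whole sphere. *)
Lemma coassociative_fibration_BS (F : set 'rV[R]_4) (c : R) :
  open F -> F !=set0 -> (forall a, F a -> 0 < c + sqnorm a) ->
  coassociative_fibration (F `*` @S3 R) (phi_BS c) (@S3 R)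
    (fibre (F `*` @S3 R)) (F `*` @S3 R) (@S3 R) (@proj_base R).
Proof.
move=> oF F0 Fc.
have m3 := @smooth_manifold_S3 R.
have m4 x : S3 x -> smooth_manifold 4 (fibre (F `*` @S3 R) x).
  by move=> ux; rewrite fibre_product//; exact: smooth_manifold_fibre.
split.
- split=> // x ux; have := m4 x ux; rewrite fibre_product// => mx.
  have co := coassociative_fibre oF Fc ux.
  split; rewrite ?regular_locus_manifold//; first by case: co.
  exact: subset_closure.
- by move=> p [Fp up]; exists p.2.
- by exists (@S3 R) => //; exact: dense_open_in_refl.
- split; first exact: dense_open_in_refl.
  + by split=> //; exists 3%N.
  + exact: smooth_fibration_product.
  + by move=> b _; apply/seteqP; split=> [p []|p [[? ?] ?]].
(* Two members through [p] have the same base point [p.2], so no point lies on two of them. *)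
- rewrite setDv; apply/esym/seteqP; split => // p [_ [b1 [b2 [_ _ b12]]]].
  by move=> [_ p1] [_ p2]; case: b12; rewrite -p1 -p2.
Qed.

End Fibration.

Theorem theorem4p1 (R : realType) :
  (forall c : R, 0 < c ->
     coassociative_fibration (@spinorS3 R) (phi_BS c) (@S3 R)
       (fibre (@spinorS3 R)) (@spinorS3 R) (@S3 R) (@proj_base R) /\
     (forall x : 'rV[R]_4, S3 x ->
        SO4_invariant x (fibre (@spinorS3 R) x) /\
        diffeomorphic (fibre (@spinorS3 R) x) [set: 'rV[R]_4])) /\
  (coassociative_fibration (@spinorS3_minus_zero R) (phi_BS 0) (@S3 R)
     (fibre (@spinorS3_minus_zero R)) (@spinorS3_minus_zero R) (@S3 R)
     (@proj_base R) /\
   (forall x : 'rV[R]_4, S3 x ->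
      SO4_invariant x (fibre (@spinorS3_minus_zero R) x) /\
      diffeomorphic (fibre (@spinorS3_minus_zero R) x)
        (~` [set (0 : 'rV[R]_4)]))).
Proof.
have -> : @spinorS3 R = [set: 'rV[R]_4] `*` @S3 R.
  by apply/seteqP; split=> p // [].
have -> : @spinorS3_minus_zero R = ~` [set (0 : 'rV[R]_4)] `*` @S3 R.
  by apply/seteqP; split=> p [] /=; [move=> ? /eqP|move=> /eqP].
split=> [c c0|]; split.
- apply: coassociative_fibration_BS; [exact: openT|by exists 0|move=> a _].
  by rewrite ltr_wpDr// sqnorm_ge0.
- move=> x ux; rewrite fibre_product//; split; last exact: diffeomorphic_fibre.
  exact: SO4_invariant_fibre.
- apply: coassociative_fibration_BS.
  + apply/closed_openC/accessible_closed_set1/hausdorff_accessible.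
    exact: norm_hausdorff.
  + by exists (row4 1 0 0 0); apply/eqP/S3_neq0/S3_one.
  + by move=> a /eqP a0; rewrite add0r lt0r sqnorm_eq0 a0 sqnorm_ge0.
- move=> x ux; rewrite fibre_product//; split; last exact: diffeomorphic_fibre.
  apply: SO4_invariant_fibre => // q1 q3 a u1 u3 /eqP a0; apply/eqP.
  (* Multiplication by unit quaternions preserves the norm, hence the complement of the origin. *)
  by rewrite -sqnorm_eq0 !sqnormM u1 u3 mul1r mulr1 sqnorm_eq0.
Qed.
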